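(* Let $(\mathcal{A},\mathrm{tr})$ be a tracial von Neumann algebra, let $a\in\mathcal{A}$, and define $$S(\lambda,\varepsilon)=\mathrm{tr}[\log((a-\lambda)^{*}(a-\lambda)+\varepsilon)],\quad \lambda\in\mathbb{C},\ \varepsilon>0.$$ Fix $\lambda\in\mathbb{C}$. Suppose that the function $$\varepsilon\mapsto\frac{\partial S}{\partial\varepsilon}(\lambda,\varepsilon),\quad \varepsilon>0,$$ admits a real-analytic extension from $(0,\infty)$ to $(-\delta,\infty)$ for some $\delta>0$. Then $a-\lambda$ is invertible, that is, $\lambda$ is outside the spectrum of $a$. Conversely, if $\lambda$ is outside the spectrum of $a$, then the function $\varepsilon\mapsto\frac{\partial S}{\partial\varepsilon}(\lambda,\varepsilon)$, $\varepsilon>0$, admits a real-analytic extension to $(-\delta,\infty)$ for some $\delta>0$.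
   Context: A tracial von Neumann algebra $(\mathcal{A},\mathrm{tr})$ is a von Neumann algebra $\mathcal{A}$ with a faithful, normal, tracial state $\mathrm{tr}:\mathcal{A}\to\mathbb{C}$. Here $a-\lambda$ means $a-\lambda 1$, and the logarithm is defined by functional calculus. *)

(* Defs.v *)
From HB Require Import structures.
From mathcomp Require Import all_boot all_order all_algebra.
From mathcomp Require Import sesquilinear complex.
From mathcomp Require Import all_classical all_reals all_analysis.
Import Order.TTheory GRing.Theory Num.Theory.
Import numFieldNormedType.Exports.

Set Implicit Arguments.
Unset Strict Implicit.
Unset Printing Implicit Defensive.

Local Open Scope classical_set_scope.
Local Open Scope ring_scope.
Local Open Scope complex_scope.

(* Operators are plain functions H -> H with their pointwise module structure;
   the product is composition and the unit is idfun. Sets of operators are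
   required to consist of bounded ones where it matters (bounded_op). *)
Section Operators.
Variables (R : realType) (H : completeNormedModType R[i]).
Variable ip : {dot H for Num.conj}.

Implicit Types (T U : H -> H) (A : set (H -> H)) (tr : (H -> H) -> R[i]).

(* The complete norm of H is the one given by the inner product. *)
Definition hilbert_norm : Prop := forall u : H, `|u| ^+ 2 = ip u u.

Definition bounded_op T : Prop := linear T /\ continuous T.

Definition is_adjoint T T' : Prop := forall u v, ip (T u) v = ip u (T' v).

(* There is at most one adjoint because ip is definite. *)
Definition adj T : H -> H := get (is_adjoint T).

(* The complex order makes this say that (T u | u) is real and nonnegative. *)
Definition pos_op T : Prop := forall u, 0 <= ip (T u) u.

Definition le_op T U : Prop := pos_op (U - T).

Definition commutant A : set (H -> H) :=
  [set T | bounded_op T /\ forall U, A U -> T \o U = U \o T].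

Record von_neumann_algebra A : Prop := {
  vn_bounded : forall T, A T -> bounded_op T;
  vn_id : A idfun;
  vn_linear : forall (c : R[i]) T U, A T -> A U -> A (c *: T + U);
  vn_comp : forall T U, A T -> A U -> A (T \o U);
  vn_adj : forall T, A T -> exists2 T', A T' & is_adjoint T T';
  vn_bicommutant : commutant (commutant A) = A }.

Definition directed (D : set (H -> H)) : Prop :=
  D !=set0 /\
  forall T U, D T -> D U -> exists2 V, D V & le_op T V /\ le_op U V.

Definition is_lub_op A (D : set (H -> H)) T : Prop :=
  [/\ A T, forall U, D U -> le_op U T &
      forall V, A V -> (forall U, D U -> le_op U V) -> le_op T V].

(* tr carries no information outside A. Normality is preservation of suprema
   of upward directed families of positive elements of A. *)
Record faithful_normal_tracial_state A tr : Prop := {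
  tr_linear : forall (c : R[i]) T U,
    A T -> A U -> tr (c *: T + U) = c * tr T + tr U;
  tr_ge0 : forall T, A T -> pos_op T -> 0 <= tr T;
  tr_id : tr idfun = 1;
  tr_tracial : forall T U, A T -> A U -> tr (T \o U) = tr (U \o T);
  tr_faithful : forall T, A T -> pos_op T -> tr T = 0 -> T = 0;
  tr_normal : forall (D : set (H -> H)) T,
    (forall U, D U -> A U /\ pos_op U) -> directed D -> is_lub_op A D T ->
    (forall U, D U -> tr U <= tr T) /\
    (forall M : R[i], (forall U, D U -> tr U <= M) -> tr T <= M) }.

Definition invertible_in A T : Prop :=
  exists2 U, A U & T \o U = idfun /\ U \o T = idfun.

Definition spectrum A T : set R[i] :=
  [set z | ~ invertible_in A (T - z *: idfun)].

Definition poly_op (p : {poly R}) T : H -> H :=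
  \sum_(i < size p) (p`_i)%:C *: iter i T.

Definition norm_cvg (V : nat -> H -> H) T : Prop :=
  forall e : R[i], 0 < e ->
    \forall n \near \oo, forall u, `|V n u - T u| <= e * `|u|.

(* Continuous functional calculus for a self-adjoint T (whose spectrum is real):
   f(T) is the norm limit of p_n(T) for polynomials p_n converging to f
   uniformly on the spectrum of T. *)
Definition is_fun_calc A T (f : R -> R) (Y : H -> H) : Prop :=
  exists p : nat -> {poly R},
    {uniform [set t : R | spectrum A T t%:C],
       (fun n t => (p n).[t]) @ \oo --> f} /\
    norm_cvg (fun n => poly_op (p n) T) Y.

Definition fun_calc A T (f : R -> R) : H -> H := get (is_fun_calc A T f).

(* The trace of the self-adjoint operator log(...) is real; taking its real part
   only changes the type, so that log_trace is differentiated as a map R -> R. *)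
Definition log_trace A tr (a : H -> H) (lam : R[i]) (eps : R) : R :=
  let b := a - lam *: idfun in
  complex.Re (tr (fun_calc A (adj b \o b + eps%:C *: idfun) (@ln R))).

End Operators.

Definition real_analytic_on (R : realType) (D : set R) (g : R -> R) : Prop :=
  forall x, D x -> exists (c : nat -> R) (r : R), 0 < r /\
    forall y, `|y - x| < r -> pseries c (y - x) @ \oo --> g y.

Definition extends_analytically (R : realType) (h : R -> R) (delta : R) : Prop :=
  exists g : R -> R, real_analytic_on [set x | - delta < x] g /\
    forall eps, 0 < eps -> g eps = h eps.

(* Main.v *)
Require Import Defs.
From HB Require Import structures.
From mathcomp Require Import all_boot all_order all_algebra.
From mathcomp Require Import sesquilinear complex.
From mathcomp Require Import all_classical all_reals all_analysis.
From mathcomp Require Import ring lra.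
Import Order.TTheory GRing.Theory Num.Theory.
Import numFieldNormedType.Exports.

Local Open Scope classical_set_scope.
Local Open Scope ring_scope.

(** Put [b = a - lam] and [x = b^* b], and let [sigma] be the set of real [t]
    for which [x - t] is not invertible in [A]. For a function [f] that is a
    uniform limit of polynomials on [sigma] the operator [f(x)] exists, and
    [L f = Re tr f(x)] is linear, positive, normalized, and faithful: [f >= 0] on
    [sigma] and [L f = 0] force [f = 0] on [sigma] (spectral_mean_faithful). So
    [L] plays the role of integration against the spectral distribution of [x],
    and [S(lam, eps) = L (ln (t + eps))], whose derivative is the Stieltjes
    transform [G(eps) = L (1 / (t + eps))] (derive1_mean_ln).

    If [b] is invertible then [sigma] lies in some [[m, M]] with [m > 0], and
    expanding [1 / (t + eps)] in a geometric series, uniformly on [sigma], shows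
    that [G] is analytic on [(-m, +oo)] (real_analytic_mean_resolvent).

    Conversely, let [G] extend to a power series [sum c_n eps ^ n] near [0]. Then
    [(-1) ^ n c_n] is the limit of [L ((t + eta) ^ -(n + 1))] as [eta -> 0+], and
    [|c_n| <= K rho ^ -n] for some [rho > 0]. A function [f >= 0] that vanishes
    beyond [tau = rho / 4] satisfies [f <= tau (2 tau) ^ (n + 1) (t + eta) ^ -(n + 1)]
    for [eta <= tau], so [L f] is at most a multiple of [2 ^ -n] for every [n];
    hence [L f = 0], [f = 0] on [sigma], and [0] is not in [sigma]
    (mean_analytic_at0). Thus [b^* b] is invertible, [b] has a left inverse, and
    a left inverse is two-sided because the trace is faithful
    (invertible_gram).

    The calculus rests on the bound of the norm of [p(x)] by the supremum of
    [|p|] on [sigma] (peval_norm_le). If the norm [w] of [p(x)] were larger, the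
    polynomial [w ^ 2 - p ^ 2] would be positive on [sigma]; splitting it into
    linear factors over the complex numbers, each factor [x - z] would be
    invertible, whereas [w ^ 2 - p(x) ^ 2] cannot be bounded below on vectors
    that almost attain the norm [w] of [p(x)]. *)

(** * Uniform limits of polynomials on a set of reals *)

Section PolyApprox.
Context {R : realType} (sigma : set R).
Implicit Types (f g : R -> R) (p : {poly R}).

Definition polyapprox f := forall e : R, 0 < e ->
  exists p, forall t, sigma t -> `|p.[t] - f t| <= e.

Lemma polyapprox_poly p : polyapprox (fun t => p.[t]).
Proof. by move=> e e0; exists p => t _; rewrite subrr normr0 ltW. Qed.

Lemma eq_polyapprox f g : (forall t, sigma t -> f t = g t) ->
  polyapprox f -> polyapprox g.
Proof. by move=> fg ha e /ha[p hp]; exists p => t st; rewrite -fg// hp. Qed.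

Lemma polyapprox_cst (k : R) : polyapprox (fun=> k).
Proof.
by apply: eq_polyapprox (polyapprox_poly k%:P) => t _; rewrite hornerC.
Qed.

Lemma polyapprox_id : polyapprox (fun t => t).
Proof.
by apply: eq_polyapprox (polyapprox_poly 'X) => t _; rewrite hornerX.
Qed.

Lemma polyapproxD f g : polyapprox f -> polyapprox g ->
  polyapprox (fun t => f t + g t).
Proof.
move=> hf hg e e0; have e20 : 0 < e / 2 by rewrite divr_gt0.
have [p hp] := hf _ e20; have [q hq] := hg _ e20.
exists (p + q) => t st; rewrite hornerD opprD addrACA.
by rewrite (le_trans (ler_normD _ _))// [leRHS]splitr lerD ?hp ?hq.
Qed.

Lemma polyapproxZ (k : R) f : polyapprox f -> polyapprox (fun t => k * f t).
Proof.
move=> hf e e0.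
have k0 : 0 < `|k| + 1 by rewrite ltr_wpDl.
have [p hp] := hf _ (divr_gt0 e0 k0).
exists (k *: p) => t st; rewrite hornerZ -mulrBr normrM.
rewrite (le_trans (ler_pM _ _ (_ : _ <= `|k| + 1) (hp t st)))//.
  by rewrite lerDl.
by rewrite mulrC divfK ?gt_eqF.
Qed.

Lemma polyapproxN f : polyapprox f -> polyapprox (fun t => - f t).
Proof.
by move=> /(polyapproxZ (-1)); apply: eq_polyapprox => t _; rewrite mulN1r.
Qed.

Lemma polyapproxB f g : polyapprox f -> polyapprox g ->
  polyapprox (fun t => f t - g t).
Proof. by move=> hf /polyapproxN hg; exact: polyapproxD. Qed.

Lemma polyapprox_sum (F : nat -> R -> R) n :
  (forall i, (i < n)%N -> polyapprox (F i)) ->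
  polyapprox (fun t => \sum_(i < n) F i t).
Proof.
elim: n => [|n IH] hF.
  by apply: eq_polyapprox (polyapprox_cst 0) => t _; rewrite big_ord0.
apply: (@eq_polyapprox (fun t => \sum_(i < n) F i t + F n t)).
  by move=> t _; rewrite big_ord_recr.
apply: polyapproxD; last exact: hF.
by apply: IH => i i_n; apply/hF/ltnW.
Qed.

Lemma polyapprox_unif f : (forall e : R, 0 < e ->
    exists2 g, polyapprox g & forall t, sigma t -> `|g t - f t| <= e) ->
  polyapprox f.
Proof.
move=> h e e0; have e20 : 0 < e / 2 by rewrite divr_gt0.
have [g hg hgf] := h _ e20; have [p hp] := hg _ e20.
exists p => t st; rewrite -(subrKA (g t)).
by rewrite (le_trans (ler_normD _ _))// [leRHS]splitr lerD ?hp ?hgf.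
Qed.

End PolyApprox.

(** Both sides come from [ln (1 + u) <= u], the lower bound by applying it to
    [1 / (1 + u) = 1 - u / (1 + u)]. *)
Lemma ln_tangent {R : realType} (s k : R) : 0 < s -> `|k| <= s / 2 ->
  `|ln (s + k) - ln s - k / s| <= 2 * (k / s) ^+ 2.
Proof.
move=> s0 ks; set u := k / s.
have u2 : `|u| <= 2^-1.
  by rewrite /u normrM normfV (gtr0_norm s0) ler_pdivrMr// mulrC.
have [u2a u2b] : - 2^-1 <= u /\ u <= 2^-1 by apply/andP; rewrite -ler_norml.
have u0 : 0 < 1 + u by lra.
have -> : s + k = s * (1 + u) by rewrite /u; field; rewrite gt_eqF.
rewrite lnM ?posrE// [ln s + _]addrC addrK.
have h1 : ln (1 + u) <= u by rewrite (le_trans (le_ln1Dx _))//; lra.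
have h2 : - ln (1 + u) <= - u / (1 + u).
  rewrite -lnV ?posrE//; set v := - u / (1 + u).
  have -> : (1 + u)^-1 = 1 + v by rewrite /v; field; rewrite gt_eqF.
  by rewrite le_ln1Dx// /v ltr_pdivlMr//; lra.
have h3 : - u / (1 + u) <= - u + 2 * u ^+ 2.
  by rewrite ler_pdivrMr//; nra.
have : 0 <= u ^+ 2 by rewrite sqr_ge0.
by rewrite ler_norml => ?; apply/andP; split; lra.
Qed.

Section Bounded.
Context {R : realType} (sigma : set R) (M : R).
Hypothesis sM : forall t, sigma t -> `|t| <= M.
Implicit Types (f g : R -> R) (p : {poly R}).

Lemma polyapprox_bounded f : polyapprox sigma f ->
  exists2 K : R, 0 < K & forall t, sigma t -> `|f t| <= K.
Proof.
move=> /(_ 1 ltr01)[p hp].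
suff [K K0 hK] : exists2 K : R, 0 < K & forall t, sigma t -> `|p.[t]| <= K.
  exists (1 + K) => [|t st]; first by rewrite addr_gt0.
  rewrite -[f t](subKr p.[t]) [1 + K]addrC (le_trans (ler_normB _ _))//.
  by rewrite lerD ?hK// hp.
elim/poly_ind: p {hp} => [|p c [K K0 IH]].
  by exists 1 => // t _; rewrite horner0 normr0.
exists (K * `|M| + `|c| + 1) => [|t st].
  by rewrite ltr_wpDl// addr_ge0// mulr_ge0// ltW.
rewrite hornerMXaddC ler_wpDr// (le_trans (ler_normD _ _))// lerD// normrM.
by rewrite ler_pM ?IH// (le_trans (sM _ st))// ler_norm.
Qed.

Lemma polyapproxM f g : polyapprox sigma f -> polyapprox sigma g ->
  polyapprox sigma (fun t => f t * g t).
Proof.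
move=> hf hg; have [K K0 hK] := polyapprox_bounded _ hf.
apply: polyapprox_unif => e e0.
have [q hq] := hg _ (divr_gt0 e0 K0).
exists (fun t => f t * q.[t]) => [|t st]; last first.
  rewrite -mulrBr normrM (le_trans (ler_pM _ _ (hK _ st) (hq _ st)))//.
  by rewrite mulrC divfK ?gt_eqF.
have [L L0 hL] := polyapprox_bounded _ (polyapprox_poly sigma q).
move=> {e e0 hq} e e0; have [p hp] := hf _ (divr_gt0 e0 L0).
exists (p * q) => t st; rewrite hornerM -mulrBl normrM.
rewrite (le_trans (ler_pM _ _ (hp _ st) (hL _ st)))//.
by rewrite divfK ?gt_eqF.
Qed.

Lemma polyapproxX f n : polyapprox sigma f -> polyapprox sigma (fun t => f t ^+ n).
Proof.
move=> hf; elim: n => [|n IH].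
  by apply: eq_polyapprox (polyapprox_cst sigma 1) => t _; rewrite expr0.
by apply: eq_polyapprox (polyapproxM _ _ hf IH) => t _; rewrite exprS.
Qed.

(** For a constant [C] above [f] the values of [1 - f / C] stay in some
    [[0, q]] with [q < 1], so the geometric series in [1 - f / C] converges
    uniformly. *)
Lemma polyapproxV f (d : R) : polyapprox sigma f -> 0 < d ->
  (forall t, sigma t -> d <= f t) -> polyapprox sigma (fun t => (f t)^-1).
Proof.
move=> hf d0 df; have [K K0 hK] := polyapprox_bounded _ hf.
pose C := K + d; have C0 : 0 < C by rewrite addr_gt0.
pose q := 1 - d / C.
have q0 : 0 <= q by rewrite subr_ge0 ler_pdivrMr// mul1r /C ler_wpDl// ltW.
have q1 : q < 1 by rewrite ltrBlDr ltrDl divr_gt0.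
have yq t : sigma t -> 0 <= 1 - f t / C <= q.
  move=> st; rewrite subr_ge0 ler_pdivrMr// mul1r lerD2l lerN2.
  rewrite ler_pM2r ?invr_gt0// df// andbT.
  by rewrite (le_trans (ler_norm _))// (le_trans (hK _ st))// /C lerDl ltW.
have hy : polyapprox sigma (fun t => 1 - f t / C).
  apply: polyapproxB; first exact: polyapprox_cst.
  by apply: eq_polyapprox (polyapproxZ _ C^-1 _ hf) => t _; rewrite mulrC.
apply: polyapprox_unif => e e0.
have [n hn] : exists n, q ^+ n / d <= e.
  have : (fun n => q ^+ n) @ \oo --> (0 : R) by apply: cvg_expr; rewrite ger0_norm.
  move=> /cvgrPdist_le/(_ _ (mulr_gt0 e0 d0))[n _ /(_ n (leqnn n))].
  rewrite /= sub0r normrN ger0_norm ?exprn_ge0// => hn.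
  by exists n; rewrite ler_pdivrMr.
exists (fun t => C^-1 * \sum_(i < n) (1 - f t / C) ^+ i).
  apply/polyapproxZ/(polyapprox_sum _ (fun i t => (1 - f t / C) ^+ i)) => i _.
  exact: polyapproxX.
move=> t st; have ft0 : 0 < f t by rewrite (lt_le_trans d0)// df.
have -> : \sum_(i < n) (1 - f t / C) ^+ i = C / f t * (1 - (1 - f t / C) ^+ n).
  rewrite -{2}(expr1n R n) subrXX; set s := \sum_(i < n) _; set s' := \sum_(i < n) _.
  have -> : s' = s by apply: eq_bigr => i _; rewrite expr1n mul1r.
  by field; rewrite !gt_eqF.
have /andP[y0 y1] := yq _ st.
rewrite [X in `|X|](_ : _ = - ((1 - f t / C) ^+ n / f t)); last first.
  by field; rewrite !gt_eqF.
rewrite normrN ger0_norm ?divr_ge0 ?exprn_ge0// ?(ltW ft0)//.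
rewrite (le_trans _ hn)// ler_pM ?exprn_ge0 ?invr_ge0 ?(ltW ft0)//.
  by rewrite lerXn2r// nnegrE.
by rewrite lef_pV2 ?posrE// df.
Qed.

(** The iteration [s := s + (f ^ 2 - s ^ 2) / 2] started at [0] increases to
    [|f|]. Its error [e = |f| - s] becomes [e (1 - (|f| + s) / 2)], which is at
    most [e - e ^ 2 / 2], so that it is bounded by [2 / (n + 2)] independently
    of the point. *)
Lemma polyapprox_norm f : polyapprox sigma f ->
  (forall t, sigma t -> `|f t| <= 1) -> polyapprox sigma (fun t => `|f t|).
Proof.
move=> hf f1.
pose s := fix s n t :=
  if n is n'.+1 then s n' t + 2^-1 * (f t * f t - s n' t * s n' t) else 0.
have hs n : polyapprox sigma (s n).
  elim: n => [|n IH]; first exact: polyapprox_cst.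
  apply: polyapproxD => //; apply: polyapproxZ.
  by apply: polyapproxB; exact: polyapproxM.
have es n t : sigma t -> 0 <= s n t <= `|f t| /\ `|f t| - s n t <= 2 / n.+2%:R.
  move=> st; have a1 := f1 _ st; have a0 := normr_ge0 (f t).
  elim: n => [|n [/andP[s0 sa] IH]].
    by split; rewrite /= ?lexx// subr0 divff.
  have eff : f t * f t = `|f t| * `|f t| by rewrite -!expr2 real_normK ?num_real.
  rewrite [s n.+1 t]/= eff; set a := `|f t| in a0 a1 sa IH *.
  set x := s n t in s0 sa IH *.
  split; first by apply/andP; split; nra.
  have n2 : 0 < n.+2%:R :> R by rewrite ltr0n.
  have n3 : 0 < n.+3%:R :> R by rewrite ltr0n.
  have hu0 : 0 <= 2 / n.+2%:R :> R by rewrite divr_ge0// ltW.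
  have hu1 : 2 / n.+2%:R <= 1 :> R by rewrite ler_pdivrMr// mul1r ler_nat.
  have hu3 : 2 / n.+2%:R - (2 / n.+2%:R) ^+ 2 / 2 <= 2 / n.+3%:R :> R.
    rewrite -subr_ge0 [leRHS](_ : _ = 2 / (n.+2%:R ^+ 2 * n.+3%:R)).
      by rewrite divr_ge0// mulr_ge0 ?exprn_ge0// ltW.
    rewrite -[n.+3]addn1 natrD -/(n.+2) in n3 *.
    by move: (n.+2%:R) n2 n3 => m m0 m1; field; rewrite !gt_eqF.
  set u := 2 / n.+2%:R in IH hu0 hu1 hu3 *.
  by apply: le_trans hu3; nra.
apply: polyapprox_unif => e e0.
have [n hn] : exists n, 2 / n.+2%:R <= e.
  exists (Num.truncn (2 / e)).
  rewrite ler_pdivrMr ?ltr0n// mulrC -ler_pdivrMr//.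
  by rewrite ltW// (lt_trans (truncnS_gt _))// ltr_nat.
exists (s n) => // t st; have [/andP[_ h1] h2] := es n _ st.
by rewrite distrC ger0_norm ?subr_ge0// (le_trans h2).
Qed.

(** Telescope [ln C - ln f] along [N] equal steps from [f] to a constant [C].
    Replacing each increment by its tangent costs [O(N ^ -2)], so the sum of the
    tangents, which involves only inverses, is [O(1 / N)]-close. *)
Lemma polyapprox_ln f (d : R) : polyapprox sigma f -> 0 < d ->
  (forall t, sigma t -> d <= f t) -> polyapprox sigma (fun t => ln (f t)).
Proof.
move=> hf d0 df; have [C C0 hC] := polyapprox_bounded _ hf.
have fC t : sigma t -> f t <= C by move=> /hC; apply: le_trans (ler_norm _).
apply: polyapprox_unif => e e0.
(* the first term makes a step at most half the current value, as required by
   the tangent bound; the second one bounds the accumulated error by e *)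
pose B := (2 * (C / d)) + 2 * (C / d) ^+ 2 / e.
have c0 : 0 < C / d by rewrite divr_gt0.
have cc0 : 0 < 2 * (C / d) ^+ 2 by rewrite mulr_gt0// exprn_gt0.
pose N := (Num.truncn B).+1.
have BN : B < N%:R by exact: truncnS_gt.
have N0 : 0 < N%:R :> R by rewrite ltr0n.
pose Delta t := (C - f t) / N%:R.
pose phi j t := f t + j%:R * Delta t.
have phiS j t : phi j.+1 t = phi j t + Delta t.
  by rewrite /phi -[j.+1]addn1 natrD mulrDl mul1r addrA.
have hD : polyapprox sigma Delta.
  have : polyapprox sigma (fun t => N%:R^-1 * (C - f t)).
    by apply/polyapproxZ/polyapproxB => //; apply: polyapprox_cst.
  by apply: eq_polyapprox => t _; rewrite mulrC.
have D0 t : sigma t -> 0 <= Delta t.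
  by move=> /fC h; rewrite divr_ge0 ?subr_ge0 ?ler0n.
have dphi j t : sigma t -> d <= phi j t.
  by move=> st; rewrite /phi ler_wpDr ?df// mulr_ge0 ?D0.
exists (fun t => ln C - \sum_(j < N) Delta t / phi j t).
  apply: polyapproxB; first exact: polyapprox_cst.
  apply: (polyapprox_sum _ (fun j t => Delta t / phi j t)) => j _.
  apply: polyapproxM => //; apply: (polyapproxV _ _ _ d0); last exact: dphi.
  by apply: polyapproxD => //; apply: polyapproxZ.
move=> t st; have ft0 : 0 < f t by rewrite (lt_le_trans d0)// df.
have phi0 j : 0 < phi j t by rewrite (lt_le_trans d0)// dphi.
have -> : ln C = ln (f t) + \sum_(j < N) (ln (phi j.+1 t) - ln (phi j t)).
  rewrite -(big_mkord xpredT (fun j => ln (phi j.+1 t) - ln (phi j t))).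
  rewrite telescope_sumr// {2}/phi mul0r addr0 addrCA subrr addr0.
  by congr ln; rewrite /phi /Delta mulrC divfK ?gt_eqF// addrCA subrr addr0.
rewrite addrAC [ln (f t) + _]addrC addrK -sumrB.
rewrite (le_trans (ler_norm_sum _ _ _))//.
have Dd : Delta t <= C / N%:R.
  by rewrite /Delta ler_pM2r ?invr_gt0// gerBl ltW.
apply: (@le_trans _ _ (\sum_(j < N) 2 * (C / d) ^+ 2 / N%:R ^+ 2)).
  apply: ler_sum => j _; rewrite phiS.
  have hj : Delta t <= phi j t / 2.
    rewrite (le_trans Dd)// ler_pdivlMr// (le_trans _ (dphi j _ st))//.
    rewrite mulrAC ler_pdivrMr// mulrC -ler_pdivrMl// ltW// (le_lt_trans _ BN)//.
    by rewrite (_ : _ * _ = 2 * (C / d)) ?lerDl ?divr_ge0 ?(ltW cc0) ?(ltW e0)//; ring.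
  rewrite (le_trans (ln_tangent _ _ _ _))//; first by rewrite ger0_norm ?D0.
  rewrite -mulrA ler_pM2l// -exprVn -exprMn lerXn2r ?nnegrE//.
  - by rewrite divr_ge0 ?D0 ?ltW.
  - by rewrite !divr_ge0 ?ltW.
  rewrite [leRHS]mulrAC; apply: ler_pM => //; first exact: D0.
    by rewrite invr_ge0 ltW.
  by rewrite lef_pV2 ?posrE ?dphi.
rewrite sumr_const card_ord -mulr_natr.
rewrite [leLHS](_ : _ = 2 * (C / d) ^+ 2 / N%:R); last by field; rewrite !gt_eqF.
rewrite ler_pdivrMr// [leRHS]mulrC -ler_pdivrMr// (le_trans _ (ltW BN))//.
by rewrite lerDr mulr_ge0// ltW.
Qed.

End Bounded.

(** * Faithful positive functionals *)

(** Integration against a probability measure with support [sigma], seen only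
    through the functions that are uniform limits of polynomials. *)
Record faithful_mean {R : realType} (sigma : set R) (L : (R -> R) -> R) : Prop := {
  mean_lin : forall k f g, polyapprox sigma f -> polyapprox sigma g ->
    L (fun t => k * f t + g t) = k * L f + L g;
  mean_ge0 : forall f, polyapprox sigma f -> (forall t, sigma t -> 0 <= f t) ->
    0 <= L f;
  mean1 : L (fun=> 1) = 1;
  mean_faithful : forall f, polyapprox sigma f ->
    (forall t, sigma t -> 0 <= f t) -> L f = 0 -> forall t, sigma t -> f t = 0 }.

Section MeanTheory.
Context {R : realType} (sigma : set R) (L : (R -> R) -> R).
Hypothesis Lm : faithful_mean sigma L.
Implicit Types (f g : R -> R).

Lemma mean_le f g : polyapprox sigma f -> polyapprox sigma g ->
  (forall t, sigma t -> f t <= g t) -> L f <= L g.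
Proof.
move=> hf hg fg; have hN : polyapprox sigma (fun t => -1 * f t + g t).
  by apply: polyapproxD => //; exact: polyapproxZ.
have := mean_ge0 _ _ Lm _ hN; rewrite (mean_lin _ _ Lm)// mulN1r addrC subr_ge0; apply.
by move=> t st; rewrite mulN1r addrC subr_ge0 fg.
Qed.

Lemma eq_mean f g : polyapprox sigma f -> polyapprox sigma g ->
  (forall t, sigma t -> f t = g t) -> L f = L g.
Proof.
by move=> hf hg fg; apply/eqP; rewrite eq_le !mean_le// => t st; rewrite fg.
Qed.

Lemma meanZ k f : polyapprox sigma f -> L (fun t => k * f t) = k * L f.
Proof.
move=> hf; have h0 : L (fun=> 0) = 0.
  have := mean_lin _ _ Lm (-1) _ _ (polyapprox_cst sigma 1) (polyapprox_cst sigma 1).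
  by rewrite !mulN1r !addNr.
have := mean_lin _ _ Lm k _ _ hf (polyapprox_cst sigma 0).
rewrite h0 addr0 => <-; congr L.
by apply/funext => t; rewrite addr0.
Qed.

Lemma meanD f g : polyapprox sigma f -> polyapprox sigma g ->
  L (fun t => f t + g t) = L f + L g.
Proof.
move=> hf hg; have := mean_lin _ _ Lm 1 _ _ hf hg; rewrite mul1r => <-.
by congr L; apply/funext => t; rewrite mul1r.
Qed.

Lemma meanB f g : polyapprox sigma f -> polyapprox sigma g ->
  L (fun t => f t - g t) = L f - L g.
Proof.
move=> hf hg; rewrite meanD//; last exact: polyapproxN.
congr (_ + _); rewrite -mulN1r -meanZ//.
by congr L; apply/funext => t; rewrite mulN1r.
Qed.

Lemma mean_cst k : L (fun=> k) = k.
Proof.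
have := meanZ k _ (polyapprox_cst sigma 1); rewrite (mean1 _ _ Lm) mulr1 => {2}<-.
by congr L; apply/funext => t; rewrite mulr1.
Qed.

Lemma mean_sum (F : nat -> R -> R) n :
  (forall i, (i < n)%N -> polyapprox sigma (F i)) ->
  L (fun t => \sum_(i < n) F i t) = \sum_(i < n) L (F i).
Proof.
elim: n => [|n IH] hF.
  rewrite big_ord0 -[RHS](mean_cst 0); congr L.
  by apply/funext => t; rewrite big_ord0.
have hn i : (i < n)%N -> polyapprox sigma (F i) by move=> /ltnW; exact: hF.
rewrite big_ord_recr/= -IH// -meanD//; first last.
- exact: hF.
- exact: polyapprox_sum.
by congr L; apply/funext => t; rewrite big_ord_recr.
Qed.

Lemma mean_norm f (k : R) : polyapprox sigma f ->
  (forall t, sigma t -> `|f t| <= k) -> `|L f| <= k.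
Proof.
move=> hf fk; have hc x := polyapprox_cst sigma x.
rewrite ler_norml -{2}(mean_cst k) -(mean_cst (- k)).
by rewrite !mean_le// => t /fk; rewrite ler_norml => /andP[].
Qed.

End MeanTheory.

(** * Power series and Stieltjes transforms *)

(** The exact remainder makes the identity usable both for the convergence of
    the expansion and for extracting one coefficient at a time. *)
Lemma geometric_remainder {R : fieldType} (a h : R) n : a != 0 -> a + h != 0 ->
  (a + h)^-1 = \sum_(k < n) (- h) ^+ k * a^-1 ^+ k.+1
    + (- h) ^+ n * (a^-1 ^+ n * (a + h)^-1).
Proof.
move=> a0 ah0; elim: n => [|n IH]; first by rewrite big_ord0 !expr0 !mul1r add0r.
rewrite {1}IH big_ord_recr/= -addrA; congr (_ + _).
rewrite !exprS; set A := a^-1 ^+ n; set B := (- h) ^+ n.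
by field; rewrite a0 ah0.
Qed.

Section PowerSeries.
Context {R : realType} (c : nat -> R) (g : R -> R) (r : R).
Hypothesis r0 : 0 < r.
Hypothesis cg : forall y, `|y| < r -> pseries c y @ \oo --> g y.

Lemma pseries_coef_le : exists2 K, 0 < K &
  forall k, `|c k| <= K / (r / 2) ^+ k.
Proof.
have r2 : 0 < r / 2 by rewrite divr_gt0.
have : cvgn (pseries c (r / 2)).
  apply/cvg_ex; exists (g (r / 2)); apply: cg.
  by rewrite gtr0_norm// ltr_pdivrMr// ltr_pMr// ltr1n.
move=> /cvg_series_cvg_0 h0; have /cvg_seq_bounded : cvgn (fun k => c k * (r / 2) ^+ k).
  by apply/cvg_ex; exists 0.
move=> /ex_bound[|K hK]; first exact: (@globally_properfilter _ _ 0%N).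
exists (`|K| + 1) => [|k]; first by rewrite ltr_wpDl.
rewrite ler_pdivlMr ?exprn_gt0// -[X in _ * X]ger0_norm ?exprn_ge0 ?(ltW r2)//.
by rewrite -normrM (le_trans (hK _ I))// (le_trans (ler_norm _))// lerDl.
Qed.

(** The shifted series [c n + c n.+1 y + ...] is [c n + O(y)], by the geometric
    bound on the coefficients; staying below half of the radius [r / 2] makes
    the tail at most twice its first term. *)
Lemma pseries_taylor n : exists2 K, 0 < K & forall y, 0 < y <= r / 4 ->
  `|(g y - \sum_(k < n) c k * y ^+ k) / y ^+ n - c n| <= K * y.
Proof.
have [K K0 hK] := pseries_coef_le; set rho := r / 2 in hK.
have rho0 : 0 < rho by rewrite divr_gt0.
exists (2 * K / rho ^+ n.+1) => [|y /andP[y0 yr]].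
  by rewrite divr_gt0 ?mulr_gt0// exprn_gt0.
pose q := y / rho.
have q0 : 0 <= q by rewrite divr_ge0 ?ltW.
have q2 : q <= 2^-1 by rewrite ler_pdivrMr// /rho; lra.
have tail N : `|\sum_(n.+1 <= k < N.+1 + n) c k * y ^+ k| <= 2 * K * q ^+ n.+1.
  (* strengthened for the induction on N *)
  suff : `|\sum_(n.+1 <= k < N.+1 + n) c k * y ^+ k| <=
      2 * K * (q ^+ n.+1 - q ^+ (N.+1 + n)).
    move=> /le_trans; apply; rewrite ler_pM2l ?mulr_gt0// gerBl.
    exact: exprn_ge0.
  elim: N => [|N IH]; first by rewrite add1n big_geq// normr0 subrr mulr0.
  rewrite [in leLHS]addSn big_nat_recr ?leq_addl//=; last first.
    by rewrite addSn ltnS leq_addl.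
  rewrite (le_trans (ler_normD _ _))//.
  have hk : `|c (N.+1 + n)%N * y ^+ (N.+1 + n)| <= K * q ^+ (N.+1 + n).
    rewrite normrM (@ger0_norm _ (y ^+ _)) ?exprn_ge0 ?(ltW y0)//.
    by rewrite /q expr_div_n mulrA mulrAC ler_wpM2r ?exprn_ge0 ?(ltW y0).
  rewrite (le_trans (lerD IH hk))// [(N.+2 + n)%N]addSn (exprS q (N.+1 + n)%N).
  have : 0 <= K * q ^+ (N.+1 + n) * (2^-1 - q).
    by rewrite mulr_ge0 ?subr_ge0// mulr_ge0 ?exprn_ge0// ltW.
  by move: (q ^+ n.+1) (q ^+ _) => A B; lra.
have yn0 : 0 < y ^+ n by rewrite exprn_gt0.
suff h : `|g y - \sum_(k < n.+1) c k * y ^+ k| <= 2 * K * q ^+ n.+1.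
  rewrite [X in `|X|](_ : _ = (g y - \sum_(k < n.+1) c k * y ^+ k) / y ^+ n).
    rewrite normrM normfV (gtr0_norm yn0) ler_pdivrMr// (le_trans h)//.
    by rewrite /q expr_div_n -[leRHS]mulrA -exprS mulrA [leLHS]mulrAC.
  by rewrite big_ord_recr/=; field; rewrite gt_eqF.
have yr' : `|y| < r by rewrite gtr0_norm//; lra.
have cv : (fun N => series (fun k => c k * y ^+ k) (N.+1 + n)%N
      - \sum_(k < n.+1) c k * y ^+ k) @ \oo -->
    g y - \sum_(k < n.+1) c k * y ^+ k.
  apply: cvgB; last exact: cvg_cst.
  have := cg _ yr'; rewrite -(cvg_shiftn n.+1).
  by under eq_fun do rewrite -addSnnS.
rewrite -(cvg_lim _ (cvg_norm cv))//; apply: limr_le.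
  by apply/cvg_ex; eexists; exact: cvg_norm cv.
near=> N; apply: le_trans (tail N).
rewrite -(big_mkord xpredT (fun k => c k * y ^+ k)) /series/=.
rewrite (@big_cat_nat _ _ _ n.+1 0 (N.+1 + n))//= ?addSn ?ltnS ?leq_addl//.
by rewrite addrC addrK.
Unshelve. all: by end_near. Qed.

End PowerSeries.

Section Resolvent.
Context {R : realType} (sigma : set R) (L : (R -> R) -> R) (m M : R).
Hypothesis Lm : faithful_mean sigma L.
Hypothesis m0 : 0 <= m.
Hypothesis smM : forall t, sigma t -> m <= t <= M.

Let sM t : sigma t -> `|t| <= M.
Proof. by move=> /smM/andP[mt tM]; rewrite ger0_norm// (le_trans m0). Qed.

Lemma polyapprox_shift (x : R) : polyapprox sigma (fun t => t + x).
Proof. by apply: polyapproxD; [exact: polyapprox_id|exact: polyapprox_cst]. Qed.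

Lemma polyapprox_resolvent (x : R) : - m < x -> polyapprox sigma (fun t => (t + x)^-1).
Proof.
move=> mx; apply: (polyapproxV _ _ sM _ (m + x)) => [||t /smM/andP[mt _]].
- exact: polyapprox_shift.
- by rewrite addrC -ltrBlDr sub0r.
- by rewrite lerD2r.
Qed.

Lemma polyapprox_resolventX (x : R) n : - m < x ->
  polyapprox sigma (fun t => (t + x)^-1 ^+ n).
Proof. by move=> /polyapprox_resolvent; exact: (polyapproxX _ _ sM). Qed.

Lemma polyapprox_ln_shift (x : R) : - m < x -> polyapprox sigma (fun t => ln (t + x)).
Proof.
move=> mx; apply: (polyapprox_ln _ _ sM _ (m + x)) => [||t /smM/andP[mt _]].
- exact: polyapprox_shift.
- by rewrite addrC -ltrBlDr sub0r.
- by rewrite lerD2r.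
Qed.

(** The tangent bound for [ln] is uniform over [sigma] once the increment is at
    most [x / 2], so it passes through the functional. *)
Lemma derive1_mean_ln (S : R -> R) :
  (forall x, 0 < x -> S x = L (fun t => ln (t + x))) ->
  forall x, 0 < x -> derive1 S x = L (fun t => (t + x)^-1).
Proof.
move=> hS x x0; have pos y : 0 < y -> - m < y by apply: le_lt_trans; rewrite oppr_le0.
have key h : `|h| <= x / 2 ->
    `|S (h + x) - S x - h * L (fun t => (t + x)^-1)| <= 2 * (h / x) ^+ 2.
  move=> hx; have hx0 : 0 < h + x.
    by move: hx; rewrite ler_norml => /andP[hx _]; lra.
  have a1 := polyapprox_ln_shift _ (pos _ x0).
  have a2 := polyapprox_ln_shift _ (pos _ hx0).
  have a3 := polyapprox_resolvent _ (pos _ x0).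
  rewrite !hS// -(meanZ _ _ Lm)// -!(meanB _ _ Lm)//; first last.
  - exact: polyapproxZ.
  - exact: polyapproxB.
  apply: (mean_norm _ _ Lm) => [|t /smM/andP[mt _]].
    by apply: polyapproxB; [exact: polyapproxB|exact: polyapproxZ].
  have t0 : 0 <= t by rewrite (le_trans m0).
  have tx0 : 0 < t + x by rewrite ltr_wpDl.
  rewrite [h + x]addrC addrA (le_trans (ln_tangent _ _ tx0 _))//.
    by rewrite (le_trans hx)// ler_pM2r ?invr_gt0// lerDr.
  rewrite ler_pM2l// -[leLHS]real_normK ?num_real// -[leRHS]real_normK ?num_real//.
  rewrite lerXn2r ?nnegrE// !normrM !normfV ler_wpM2l//.
  rewrite lef_pV2 ?posrE ?normr_gt0 ?gt_eqF//.
  by rewrite !gtr0_norm// lerDr.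
apply/cvg_lim => //; apply/cvgrPdist_le => /= e e0.
near=> h.
have h0 : h != 0 by near: h; exact: nbhs_dnbhs_neq.
have hx : `|h| <= x / 2.
  by near: h; apply/dnbhs0_le; rewrite divr_gt0.
have he : `|h| <= e * x ^+ 2 / 2.
  by near: h; apply/dnbhs0_le; rewrite divr_gt0// mulr_gt0// exprn_gt0.
rewrite -[L _](mulKf h0) [X in _ - X](_ : _ = h^-1 * (S (h + x) - S x))//.
rewrite -mulrBr normrM normfV distrC.
have hn : 0 < `|h| by rewrite normr_gt0.
rewrite ler_pdivrMl// (le_trans (key _ hx))// exprMn -(real_normK (num_real h)).
rewrite expr2 -!mulrA mulrCA ler_pM2l// exprVn mulrA ler_pdivrMr ?exprn_gt0//.
by rewrite mulrC -ler_pdivlMr.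
Unshelve. all: by end_near. Qed.

Lemma mean_geometric_remainder (x h : R) n : - m < x -> - m < x + h ->
  L (fun t => (t + (x + h))^-1) =
  \sum_(k < n) (- h) ^+ k * L (fun t => (t + x)^-1 ^+ k.+1)
  + (- h) ^+ n * L (fun t => (t + x)^-1 ^+ n * (t + (x + h))^-1).
Proof.
move=> mx mxh.
have hk k := polyapprox_resolventX _ k mx.
have hb : polyapprox sigma (fun t => (t + x)^-1 ^+ n * (t + (x + h))^-1).
  by apply: (polyapproxM _ _ sM) => //; exact: polyapprox_resolvent.
under eq_bigr do rewrite -(meanZ _ _ Lm)//.
rewrite -(mean_sum _ _ Lm (fun k t => (- h) ^+ k * (t + x)^-1 ^+ k.+1)); last first.
  by move=> i _; exact: polyapproxZ.
have hs : polyapprox sigma (fun t => \sum_(k < n) (- h) ^+ k * (t + x)^-1 ^+ k.+1).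
  apply: (polyapprox_sum _ (fun k t => (- h) ^+ k * (t + x)^-1 ^+ k.+1)) => i _.
  exact: polyapproxZ.
rewrite -(meanZ _ _ Lm)// -(meanD _ _ Lm)//; last exact: polyapproxZ.
apply: (eq_mean _ _ Lm) => [||t /smM/andP[mt _]].
- exact: polyapprox_resolvent.
- by apply: polyapproxD => //; exact: polyapproxZ.
by rewrite addrA; apply: geometric_remainder; rewrite gt_eqF//; lra.
Qed.

Lemma real_analytic_mean_resolvent :
  real_analytic_on [set x | - m < x] (fun x => L (fun t => (t + x)^-1)).
Proof.
move=> x /= mx; pose d := m + x.
have d0 : 0 < d by rewrite /d; lra.
exists (fun k => (-1) ^+ k * L (fun t => (t + x)^-1 ^+ k.+1)), d; split=> // y.
set h := y - x => hd; have -> : y = x + h by rewrite addrC subrK.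
have [hd1 hd2] : - d < h /\ h < d by apply/andP; rewrite -ltr_norml.
have mxh : - m < x + h by rewrite /d in hd1; lra.
pose q := `|h| / d.
have q0 : 0 <= q by rewrite divr_ge0// ltW.
have q1 : q < 1 by rewrite ltr_pdivrMr// mul1r.
have qcv : (fun n => q ^+ n * (d + h)^-1) @ \oo --> (0 : R).
  rewrite -(mul0r (d + h)^-1); apply: cvgM; last exact: cvg_cst.
  by apply: cvg_expr; rewrite ger0_norm.
apply/cvgrPdist_le => e e0; move/cvgrPdist_le : qcv => /(_ _ e0).
apply: filterS => n /=; rewrite sub0r normrN => qn.
rewrite (le_trans _ (le_trans (ler_norm _) qn))//.
rewrite (mean_geometric_remainder _ _ n)// /pseries /series/= big_mkord.
under eq_bigr do rewrite exprNn mulrAC.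
rewrite [_ + _ * L _]addrC addrK normrM normrX normrN.
rewrite /q expr_div_n -mulrA ler_wpM2l ?exprn_ge0//.
apply: (mean_norm _ _ Lm) => [|t /smM/andP[mt _]].
  apply: (polyapproxM _ _ sM); first exact: polyapprox_resolventX.
  exact: polyapprox_resolvent.
have tx : d <= t + x by rewrite lerD2r.
have txh : d + h <= t + (x + h) by rewrite [leRHS]addrA lerD2r.
have dh0 : 0 < d + h by lra.
have tx0 := lt_le_trans d0 tx; have txh0 := lt_le_trans dh0 txh.
rewrite ger0_norm ?mulr_ge0 ?exprn_ge0 ?invr_ge0 ?(ltW tx0) ?(ltW txh0)// -exprVn.
rewrite ler_pM ?exprn_ge0 ?invr_ge0 ?(ltW tx0) ?(ltW txh0)//.
  by rewrite lerXn2r ?nnegrE ?invr_ge0 ?(ltW tx0) ?(ltW d0)// lef_pV2 ?posrE.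
by rewrite lef_pV2 ?posrE.
Qed.

End Resolvent.

(** [u n x] approximates the moment of order [-(n + 1)], [W n x y] is the mean of
    the remainder of the expansion of [1 / (t + x + y)] at order [n], and [w n y]
    is its limit as [x -> 0+], namely, up to sign, the shifted power series of
    [g]. Comparing [u n] with [W n] on both sides identifies the limit of [u n]
    with a Taylor coefficient, without differentiating the power series. *)
Section NegativeMoments.
Context {R : realType} (sigma : set R) (L : (R -> R) -> R) (M : R).
Hypothesis Lm : faithful_mean sigma L.
Hypothesis sM : forall t, sigma t -> 0 <= t <= M.
Context (c : nat -> R) (g : R -> R) (r : R).
Hypothesis r0 : 0 < r.
Hypothesis cg : forall y, `|y| < r -> pseries c y @ \oo --> g y.
Hypothesis gL : forall x, 0 < x -> g x = L (fun t => (t + x)^-1).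

Let sMn t : sigma t -> `|t| <= M.
Proof. by move=> /sM/andP[t0 tM]; rewrite ger0_norm. Qed.

Let approxX (x : R) n : 0 < x -> polyapprox sigma (fun t => (t + x)^-1 ^+ n).
Proof.
by move=> x0; apply: (polyapprox_resolventX _ _ _ (lexx 0) sM); rewrite oppr0.
Qed.

Let approxW (x y : R) n : 0 < x -> 0 < y ->
  polyapprox sigma (fun t => (t + x)^-1 ^+ n * (t + y)^-1).
Proof.
by move=> x0 y0; apply: (polyapproxM _ _ sMn); [exact: approxX|exact: (approxX _ 1)].
Qed.

Let u n (x : R) := L (fun t => (t + x)^-1 ^+ n.+1).

Let W n (x y : R) := L (fun t => (t + x)^-1 ^+ n * (t + (x + y))^-1).

Let w n (y : R) := (-1) ^+ n * ((g y - \sum_(k < n) c k * y ^+ k) / y ^+ n).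

Let W_anti n (x x' y : R) : 0 < x -> x <= x' -> 0 < y -> W n x' y <= W n x y.
Proof.
move=> x0 xx' y0; have x'0 := lt_le_trans x0 xx'.
apply: (mean_le _ _ Lm) => [||t /sM/andP[t0 _]].
- by apply: approxW => //; exact: addr_gt0.
- by apply: approxW => //; exact: addr_gt0.
have h x1 x2 : 0 < x1 -> x1 <= x2 -> (t + x2)^-1 <= (t + x1)^-1.
  move=> x10 x12; have tx1 : 0 < t + x1 by rewrite ltr_wpDl.
  by rewrite lef_pV2 ?posrE ?lerD2l// (lt_le_trans tx1)// lerD2l.
have tx : 0 <= (t + x')^-1 by rewrite invr_ge0 addr_ge0// ltW.
have txy : 0 <= (t + (x' + y))^-1 by rewrite invr_ge0 !addr_ge0// ltW.
rewrite ler_pM ?exprn_ge0//; last by apply: h; rewrite ?addr_gt0 ?lerD2r.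
by rewrite lerXn2r ?nnegrE// ?h// invr_ge0 addr_ge0// ltW.
Qed.

Let u_ge_W n (x y : R) : 0 < x -> 0 < y -> W n x y <= u n x.
Proof.
move=> x0 y0.
apply: (mean_le _ _ Lm) => [||t /sM/andP[t0 _]].
- by apply: approxW => //; exact: addr_gt0.
- exact: approxX.
have tx : 0 < t + x by rewrite ltr_wpDl.
rewrite [leRHS]exprSr ler_wpM2l// ?exprn_ge0 ?invr_ge0 ?(ltW tx)//.
by rewrite lef_pV2 ?posrE// ?addrA ?lerDl ?(ltW y0)// ltr_wpDr// ltW.
Qed.

Let u_le_W n (x : R) : 0 < x -> u n x <= W n (x / 2) (x / 2).
Proof.
move=> x0; have x20 : 0 < x / 2 by rewrite divr_gt0.
apply: (mean_le _ _ Lm) => [||t /sM/andP[t0 _]].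
- exact: approxX.
- by apply: approxW => //; exact: addr_gt0.
have tx : 0 < t + x by rewrite ltr_wpDl.
have tx2 : 0 < t + x / 2 by rewrite ltr_wpDl.
rewrite -splitr [leLHS]exprSr ler_wpM2r// ?invr_ge0 ?(ltW tx)//.
rewrite lerXn2r ?nnegrE ?invr_ge0 ?(ltW tx) ?(ltW tx2)// lef_pV2 ?posrE// lerD2l.
by rewrite ler_pdivrMr// ler_pMr// ler1n.
Qed.

(** In the expansion of [L (1 / (t + x + y))] at order [n], every term but
    [(- y) ^ n * W n x y] has a known limit. *)
Let W_cvg n (y : R) :
  (forall k, (k < n)%N -> u k x @[x --> 0^'+] --> (-1) ^+ k * c k) ->
  0 < y -> W n x y @[x --> 0^'+] --> w n y.
Proof.
move=> IH y0.
have G : L (fun t => (t + (x + y))^-1) @[x --> 0^'+] --> g y.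
  rewrite gL//; apply/cvgrPdist_le => e e0; near=> x.
  have x0 : 0 < x by near: x; exact: nbhs_right_gt.
  have xy0 : 0 < x + y by exact: addr_gt0.
  rewrite -(meanB _ _ Lm); [|exact: (approxX _ 1)|exact: (approxX _ 1)].
  apply: (mean_norm _ _ Lm) => [|t /sM/andP[t0 _]].
    by apply: polyapproxB; exact: (approxX _ 1).
  have ty : 0 < t + y by rewrite ltr_wpDl.
  have txy : 0 < t + (x + y) by rewrite ltr_wpDl.
  rewrite [X in `|X|](_ : _ = x / ((t + y) * (t + (x + y)))); last first.
    by field; rewrite !gt_eqF.
  rewrite ger0_norm ?divr_ge0 ?mulr_ge0 ?(ltW x0) ?(ltW ty) ?(ltW txy)//.
  apply: (@le_trans _ _ (x / (y * y))).
    rewrite ler_pM2l// lef_pV2 ?posrE ?mulr_gt0// ler_pM ?(ltW y0)// ?lerDr//.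
    by rewrite addrA lerDr addr_ge0// ltW.
  rewrite ler_pdivrMr ?mulr_gt0//.
  by near: x; apply: nbhs_right_le; rewrite !mulr_gt0.
rewrite (_ : w n y =
  (g y - \sum_(k < n) (- y) ^+ k * ((-1) ^+ k * c k)) / (- y) ^+ n); last first.
  rewrite /w (exprNn y n) invfM invr_sign mulrCA; congr (_ * (_ / _)).
  congr (_ - _); apply: eq_bigr => k _.
  by rewrite mulrA -exprMn mulrN1 opprK mulrC.
have : (L (fun t => (t + (x + y))^-1) - \sum_(k < n) (- y) ^+ k * u k x) / (- y) ^+ n
    @[x --> 0^'+] --> (g y - \sum_(k < n) (- y) ^+ k * ((-1) ^+ k * c k)) / (- y) ^+ n.
  apply: cvgM; last exact: cvg_cst.
  apply: cvgB => //; apply: cvg_big => [|k _]; first exact: add_continuous.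
  by apply: cvgM; [exact: cvg_cst|exact: IH].
apply: cvg_trans; apply: near_eq_cvg; near=> x.
have x0 : 0 < x by near: x; exact: nbhs_right_gt.
rewrite (mean_geometric_remainder _ _ _ _ Lm (lexx 0) sM x y n) ?oppr0 ?addr_gt0//.
by rewrite [\sum_(_ < _) _ + _]addrC addrK mulrC mulKf// expf_neq0// oppr_eq0 gt_eqF.
Unshelve. all: by end_near. Qed.

(** From above, [u n x <= W n (x / 2) (x / 2) <= w n (x / 2)], since [W n] is
    monotone in its first argument; from below, [W n x y <= u n x] for a fixed
    small [y]. Both bounds tend to [(-1) ^ n * c n] because [w n] does at [0]. *)
Let u_cvg n : u n x @[x --> 0^'+] --> (-1) ^+ n * c n.
Proof.
elim/ltn_ind: n => n IH.
have [K K0 hK] := pseries_taylor _ _ _ r0 cg n.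
have hw y : 0 < y <= r / 4 -> `|w n y - (-1) ^+ n * c n| <= K * y.
  by move=> /hK; rewrite -mulrBr normrM normrX normrN1 expr1n mul1r.
have Ww x y : 0 < x -> 0 < y -> W n x y <= w n y.
  move=> x0 y0; have h := W_cvg _ _ IH y0.
  rewrite -(cvg_lim _ h)//; apply: limr_ge; first by apply/cvg_ex; eexists; exact: h.
  near=> x'; apply: W_anti => //; near: x'; exact: nbhs_right_le.
apply/cvgrPdist_le => e e0.
pose y := Num.min (r / 4) (e / (2 * K)).
have y0 : 0 < y by rewrite lt_min !divr_gt0// mulr_gt0.
have ye : K * y <= e / 2.
  have : y <= e / (2 * K) by rewrite ge_min lexx orbT.
  by rewrite !ler_pdivlMr ?mulr_gt0// (_ : K * y * 2 = y * (2 * K))//; ring.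
have hy y' : 0 < y' <= y -> `|w n y' - (-1) ^+ n * c n| <= e / 2.
  move=> /andP[y'0 y'y]; rewrite (le_trans (hw _ _))//.
    by rewrite y'0 (le_trans y'y)// ge_min lexx.
  by rewrite (le_trans _ ye)// ler_pM2l.
near=> x.
have x0 : 0 < x by near: x; exact: nbhs_right_gt.
have xy : x <= y by near: x; exact: nbhs_right_le.
have lo : w n y - W n x y <= e / 2.
  rewrite (le_trans (ler_norm _))//; near: x.
  by have /cvgrPdist_le := W_cvg _ _ IH y0; apply; rewrite divr_gt0.
have x20 : 0 < x / 2 by rewrite divr_gt0.
have := hy _ (_ : 0 < y <= y); rewrite y0 lexx => /(_ isT).
have := hy (x / 2); rewrite x20 (le_trans _ xy)/=; last first.
  by rewrite ler_pdivrMr// ler_pMr// ler1n.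
move=> /(_ isT).
have := u_ge_W n _ _ x0 y0; have := u_le_W n _ x0; have := Ww _ _ x20 x20.
rewrite !ler_norml => h1 h2 h3 /andP[h4 h5] /andP[h6 h7].
by apply/andP; split; lra.
Unshelve. all: by end_near. Qed.

(** By positivity and faithfulness any [f >= 0] with [f 0 > 0] has a positive
    mean. For [f = max (tau - t) 0] this makes the negative moments, hence the
    coefficients [c n], grow faster than the radius of convergence permits. *)
Lemma mean_analytic_at0 : ~ sigma 0.
Proof.
move=> s0.
have [K K0 hK] := pseries_coef_le _ _ _ r0 cg; set rho := r / 2 in hK.
have rho0 : 0 < rho by rewrite divr_gt0.
(* on the support of f, t + x <= 2 tau = rho / 2 for all x <= tau *)
pose tau := rho / 4; have tau0 : 0 < tau by rewrite divr_gt0.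
pose f t := 2^-1 * ((tau - t) + `|tau - t|).
pose B := tau + `|M|; have B0 : 0 < B by rewrite ltr_pwDl.
have ht : polyapprox sigma (fun t => tau - t).
  by apply: polyapproxB; [exact: polyapprox_cst|exact: polyapprox_id].
have hf : polyapprox sigma f.
  apply/polyapproxZ/polyapproxD => //.
  have h : polyapprox sigma (fun t => `|B^-1 * (tau - t)|).
    apply: (polyapprox_norm _ _ sMn); first exact: polyapproxZ.
    move=> t /sMn tM; rewrite normrM normfV (gtr0_norm B0) ler_pdivrMl// mulr1.
    rewrite (le_trans (ler_normB _ _))// (gtr0_norm tau0) lerD2l.
    by rewrite (le_trans tM)// ler_norm.
  apply: eq_polyapprox (polyapproxZ _ B _ h) => t _.
  by rewrite normrM normfV (gtr0_norm B0) mulVKf// gt_eqF.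
have f0 t : 0 <= f t by rewrite mulr_ge0// -lerBlDl sub0r ler_normlW// normrN.
have v0 : 0 < L f.
  rewrite lt_def (mean_ge0 _ _ Lm) ?andbT//; apply/eqP => Lf0.
  have := mean_faithful _ _ Lm _ hf (fun t _ => f0 t) Lf0 _ s0.
  rewrite /f subr0 (gtr0_norm tau0) => /eqP.
  by rewrite mulf_eq0 invr_eq0 pnatr_eq0/= gt_eqF// addr_gt0.
have low n x : 0 < x <= tau -> (rho / 2)^-1 ^+ n.+1 * tau^-1 * L f <= u n x.
  move=> /andP[x0 xtau]; rewrite -(meanZ _ _ Lm)//.
  apply: (mean_le _ _ Lm) => [||t /sM/andP[t0 _]]; [exact: polyapproxZ|exact: approxX|].
  have tx0 : 0 < t + x by rewrite ltr_wpDl.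
  have [tt|tt] := leP tau t.
    rewrite /f ler0_norm ?subr_le0// subrr !mulr0 exprn_ge0// invr_ge0.
    exact: ltW.
  have ft : f t <= tau.
    by rewrite /f gtr0_norm ?subr_gt0//; lra.
  have rho2 : 0 < rho / 2 by rewrite divr_gt0.
  rewrite -mulrA -[leRHS]mulr1; apply: ler_pM.
  - by rewrite exprn_ge0// invr_ge0 ltW.
  - by rewrite (mulr_ge0 _ (f0 t))// invr_ge0 ltW.
  - rewrite lerXn2r ?nnegrE ?invr_ge0 ?(ltW tx0) ?(ltW rho2)//.
    by rewrite lef_pV2 ?posrE//; rewrite /tau in xtau tt; lra.
  by rewrite ler_pdivrMl// mulr1.
have lim n : (rho / 2)^-1 ^+ n.+1 * tau^-1 * L f <= K / rho ^+ n.
  rewrite (le_trans _ (hK n))//.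
  apply: (@le_trans _ _ ((-1) ^+ n * c n)); last first.
    by rewrite (le_trans (ler_norm _))// normrM normrX normrN1 expr1n mul1r.
  rewrite -(cvg_lim _ (u_cvg n))//; apply: limr_ge.
    by apply/cvg_ex; eexists; exact: u_cvg.
  near=> x; apply: low; apply/andP; split; near: x.
    exact: nbhs_right_gt.
  exact: nbhs_right_le.
pose Z := K * rho * tau / (2 * L f).
have opnorm_le n : n%:R <= Z.
  apply: (@le_trans _ _ (2 ^+ n)); first by rewrite -natrX ler_nat ltnW// ltn_expl.
  rewrite /Z ler_pdivlMr ?mulr_gt0//.
  have := lim n; rewrite -(ler_pM2r (exprn_gt0 n.+1 rho0)) -(ler_pM2r tau0).
  rewrite [leLHS](_ : _ = 2 ^+ n * (2 * L f)).
    by rewrite [leRHS](_ : _ = K * rho * tau)// exprS; field; rewrite gt_eqF// exprn_gt0.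
  rewrite invf_div expr_div_n !exprS; field.
  by rewrite !gt_eqF// exprn_gt0.
have := opnorm_le (Num.truncn Z).+1; apply/negP; rewrite -ltNge.
exact: truncnS_gt.
Unshelve. all: by end_near. Qed.

End NegativeMoments.

(** * The real Hilbert space structure *)

(** The norm and the real part of the inner product, as real numbers: all
    estimates on self-adjoint operators take place in this real inner product
    space. *)
Section RealNorm.
Context {R : realType} {H : completeNormedModType R[i]}.
Implicit Types (u v : H).

Definition nrm u : R := complex.Re `|u|.

Lemma nrmE u : `|u| = ((nrm u)%:C)%C.
Proof. by rewrite RRe_real// ger0_real. Qed.

Lemma nrm_ge0 u : 0 <= nrm u.
Proof. by rewrite -ler0c -nrmE. Qed.

Lemma nrmD u v : nrm (u + v) <= nrm u + nrm v.
Proof. by rewrite -lecR rmorphD/= -!nrmE ler_normD. Qed.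

Lemma nrm0 : nrm 0 = 0.
Proof. by rewrite /nrm normr0. Qed.

Lemma nrm0_eq0 u : nrm u = 0 -> u = 0.
Proof. by move=> u0; apply/eqP; rewrite -normr_eq0 nrmE u0. Qed.

Lemma nrmZ (c : R[i]) u : nrm (c *: u) = complex.Re `|c| * nrm u.
Proof.
apply: complexI; rewrite -nrmE normrZ nrmE rmorphM/=.
by rewrite RRe_real// ger0_real.
Qed.

Lemma nrmN u : nrm (- u) = nrm u.
Proof. by rewrite /nrm normrN. Qed.

Lemma nrmB u v : nrm (u - v) = nrm (v - u).
Proof. by rewrite -opprB nrmN. Qed.

Lemma nrm_eq0 u : (forall d, 0 < d -> nrm u <= d) -> u = 0.
Proof.
move=> h; apply: nrm0_eq0; apply/eqP; rewrite eq_le nrm_ge0 andbT.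
by apply/ler_addgt0Pr => e e0; rewrite add0r h.
Qed.

Lemma nrm_complete (x : nat -> H) :
  (forall e, 0 < e -> exists N, forall m n, (N <= m)%N -> (N <= n)%N ->
     nrm (x m - x n) <= e) ->
  exists y, forall e, 0 < e -> exists N, forall n, (N <= n)%N -> nrm (x n - y) <= e.
Proof.
move=> hx.
have : cvg (x @ \oo).
  apply/cauchy_cvgP/cauchy_ballP => e e0.
  have [er e'0] : ((complex.Re e)%:C)%C = e /\ 0 < complex.Re e.
    split; first by rewrite RRe_real// gtr0_real.
    by rewrite -ltcR RRe_real// gtr0_real.
  have [N hN] := hx _ (divr_gt0 e'0 (ltr0n _ 2)).
  exists (x @` [set n | (N <= n)%N], x @` [set n | (N <= n)%N]).
    by split; exists N => // n nN; exists n.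
  move=> [_ _] /= [[m mN <-] [n nN <-]]; rewrite -ball_normE/= nrmE -er ltcR.
  rewrite (le_lt_trans (hN _ _ mN nN))// ltr_pdivrMr// ltr_pMr//.
  by rewrite ltr1n.
move=> /cvg_ex[y xy]; exists y => e e0.
have ec0 : 0 < (e%:C)%C :> R[i] by rewrite ltcR.
move/cvgrPdist_le : xy => /(_ _ ec0)[N _ hN]; exists N => n Nn.
by have := hN n Nn; rewrite /= nrmE lecR nrmB.
Qed.

Lemma bounded_opP (T : H -> H) : linear T ->
  continuous T <-> exists2 K, 0 < K & forall u, nrm (T u) <= K * nrm u.
Proof.
move=> lT; pose f : {linear H -> H} := HB.pack T (GRing.isLinear.Build _ _ _ _ T lT).
have -> : continuous T = continuous f by [].
rewrite -linear_bounded_continuous linear_boundedP; split.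
  move=> /pinfty_ex_gt0[K K0 hK]; exists (complex.Re K).
    by rewrite -ltcR RRe_real// gtr0_real.
  move=> u; rewrite -lecR -nrmE rmorphM/= RRe_real ?gtr0_real// -nrmE.
  exact: hK.
move=> [K K0 hK]; exists (K%:C)%C; split; first by rewrite complex_real.
move=> r Kr u; rewrite (le_trans _ (ler_wpM2r _ (ltW Kr)))//.
by rewrite [`|f u|]nrmE [`|u|]nrmE -rmorphM lecR hK.
Qed.

End RealNorm.

Section InnerProduct.
Context {R : realType} {H : completeNormedModType R[i]}.
Context (ip : {dot H for Num.conj}).
Hypothesis hH : hilbert_norm ip.
Implicit Types (u v : H).

Definition re_ip u v : R := complex.Re (ip u v).
Local Notation rip := re_ip.

Lemma ripC u v : rip u v = rip v u.
Proof.
have ReJ (z : R[i]) : complex.Re (Num.conj z) = complex.Re z by case: z.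
by rewrite /re_ip (hermC ip) expr0 mul1r ReJ.
Qed.

Lemma ripDl u v w : rip (u + v) w = rip u w + rip v w.
Proof. by rewrite /re_ip linearDl raddfD. Qed.

Lemma ripNl u v : rip (- u) v = - rip u v.
Proof. by rewrite /re_ip linearNl raddfN. Qed.

Lemma ripBl u v w : rip (u - v) w = rip u w - rip v w.
Proof. by rewrite ripDl ripNl. Qed.

Lemma ripDr u v w : rip u (v + w) = rip u v + rip u w.
Proof. by rewrite ripC ripDl !(ripC u). Qed.

Lemma ripNr u v : rip u (- v) = - rip u v.
Proof. by rewrite ripC ripNl ripC. Qed.

Lemma ripZl (k : R) u v : rip ((k%:C)%C *: u) v = k * rip u v.
Proof.
by rewrite /re_ip linearZl_LR/=; case: (ip u v) => a b /=; rewrite mul0r subr0.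
Qed.

Lemma ripZr (k : R) u v : rip u ((k%:C)%C *: v) = k * rip u v.
Proof. by rewrite ripC ripZl ripC. Qed.

Lemma nrm2 u : nrm u ^+ 2 = rip u u.
Proof. by rewrite /re_ip -hH nrmE -rmorphXn. Qed.

(** Since the norm of the space is known to be a norm, the triangle inequality
    for [u + v] gives the result upon squaring. *)
Lemma cauchy_schwarz u v : `|rip u v| <= nrm u * nrm v.
Proof.
have h w : 2 * rip u w <= 2 * (nrm u * nrm w).
  have := nrmD u w; rewrite -(@ler_pXn2r _ 2) ?nnegrE ?addr_ge0 ?nrm_ge0//.
  rewrite nrm2 ripDl !ripDr (ripC w u) sqrrD !nrm2 !mulr2n.
  by move: (rip _ _) (rip _ _) (rip _ _) => a b c; lra.
rewrite ler_norml; apply/andP; split; last by rewrite -(ler_pM2l (ltr0n _ 2)) h.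
by have := h (- v); rewrite nrmN ripNr; lra.
Qed.

End InnerProduct.

(** * A von Neumann algebra as a unital algebra *)

Section Algebra.
Context {R : realType} {H : completeNormedModType R[i]} {ip : {dot H for Num.conj}}.
Context {A : set (H -> H)} (hA : von_neumann_algebra ip A).
Context (A1 : (idfun : H -> H) <> 0).

(** The parameters carry the closure properties of [A] and the nontriviality of
    the space, which the algebra structure declared on this type depends on. *)
Record vnalg (hA : von_neumann_algebra ip A) (A1 : (idfun : H -> H) <> 0) :=
  Vnalg { vnop :> H -> H; vnopP : A vnop }.
Arguments vnop {_ _} _ _.
Arguments vnopP {_ _} _.
Arguments Vnalg {_ _} _ _.

Local Notation V := (vnalg hA A1).

HB.instance Definition _ := gen_eqMixin V.
HB.instance Definition _ := gen_choiceMixin V.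

Lemma vnalg_ext (S T : V) : vnop S =1 vnop T -> S = T.
Proof.
case: S T => [S AS] [T AT] /= /funext ST; case: _ / ST AT => AT.
by congr Vnalg; exact: Prop_irrelevance.
Qed.

Lemma vn_zero : A 0.
Proof.
have := vn_linear hA (-1) (vn_id hA) (vn_id hA).
by rewrite scaleN1r addNr.
Qed.

Lemma vn_scale (c : R[i]) T : A T -> A (c *: T).
Proof. by move=> AT; have := vn_linear hA c AT vn_zero; rewrite addr0. Qed.

Lemma vn_add S T : A S -> A T -> A (S + T).
Proof. by move=> AS AT; have := vn_linear hA 1 AS AT; rewrite scale1r. Qed.

Definition vnalg0 : V := Vnalg 0 vn_zero.
Definition vnalg1 : V := Vnalg idfun (vn_id hA).
Definition vnalgZ (c : R[i]) (T : V) : V :=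
  Vnalg (c *: vnop T) (vn_scale c _ (vnopP T)).
Definition vnalgN (T : V) : V := vnalgZ (-1) T.
Definition vnalgD (S T : V) : V :=
  Vnalg (vnop S + vnop T) (vn_add _ _ (vnopP S) (vnopP T)).
Definition vnalgM (S T : V) : V :=
  Vnalg (vnop S \o vnop T) (vn_comp hA (vnopP S) (vnopP T)).

Lemma vnop_linear (T : V) : linear (vnop T).
Proof. by have [] := vn_bounded hA (vnopP T). Qed.

HB.instance Definition _ (T : V) :=
  GRing.isLinear.Build R[i] H H *:%R (vnop T) (vnop_linear T).

Lemma vnalgDA : associative vnalgD.
Proof. by move=> S T U; apply: vnalg_ext => u /=; rewrite addrA. Qed.
Lemma vnalgDC : commutative vnalgD.
Proof. by move=> S T; apply: vnalg_ext => u /=; rewrite addrC. Qed.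
Lemma vnalg0D : left_id vnalg0 vnalgD.
Proof. by move=> T; apply: vnalg_ext => u /=; rewrite add0r. Qed.
Lemma vnalgND : left_inverse vnalg0 vnalgN vnalgD.
Proof. by move=> T; apply: vnalg_ext => u /=; rewrite scaleN1r addNr. Qed.

HB.instance Definition _ :=
  GRing.isZmodule.Build V vnalgDA vnalgDC vnalg0D vnalgND.

Lemma vnalgMA : associative vnalgM.
Proof. by move=> S T U; apply: vnalg_ext. Qed.
Lemma vnalg1M : left_id vnalg1 vnalgM.
Proof. by move=> T; apply: vnalg_ext. Qed.
Lemma vnalgM1 : right_id vnalg1 vnalgM.
Proof. by move=> T; apply: vnalg_ext. Qed.
Lemma vnalgMDl : left_distributive vnalgM vnalgD.
Proof. by move=> S T U; apply: vnalg_ext. Qed.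
Lemma vnalgMDr : right_distributive vnalgM vnalgD.
Proof. by move=> S T U; apply: vnalg_ext => u /=; exact: linearD. Qed.
Lemma vnalg1_neq0 : vnalg1 != 0.
Proof. by apply/eqP => -[] /A1. Qed.

HB.instance Definition _ :=
  GRing.Zmodule_isNzRing.Build V vnalgMA vnalg1M vnalgM1 vnalgMDl vnalgMDr vnalg1_neq0.

Lemma vnalgZA (c d : R[i]) (T : V) : vnalgZ c (vnalgZ d T) = vnalgZ (c * d) T.
Proof. by apply: vnalg_ext => u /=; rewrite scalerA. Qed.
Lemma vnalg1Z : left_id 1 vnalgZ.
Proof. by move=> T; apply: vnalg_ext => u /=; rewrite scale1r. Qed.
Lemma vnalgZDr : right_distributive vnalgZ +%R.
Proof. by move=> c S T; apply: vnalg_ext => u /=; rewrite scalerDr. Qed.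
Lemma vnalgZDl (T : V) : {morph vnalgZ^~ T : c d / c + d}.
Proof. by move=> c d; apply: vnalg_ext => u /=; rewrite scalerDl. Qed.

HB.instance Definition _ :=
  GRing.Zmodule_isLmodule.Build R[i] V vnalgZA vnalg1Z vnalgZDr vnalgZDl.

Lemma vnalgZAl (c : R[i]) (S T : V) : c *: (S * T) = c *: S * T.
Proof. exact: vnalg_ext. Qed.
HB.instance Definition _ := GRing.Lmodule_isLalgebra.Build R[i] V vnalgZAl.
Lemma vnalgZAr (c : R[i]) (S T : V) : c *: (S * T) = S * (c *: T).
Proof. by apply: vnalg_ext => u; rewrite /= [RHS]linearZ. Qed.
HB.instance Definition _ := GRing.Lalgebra_isAlgebra.Build R[i] V vnalgZAr.

End Algebra.

Arguments vnop {_ _ _ _ _ _} _ _.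
Arguments vnopP {_ _ _ _ _ _} _.
Arguments Vnalg {_ _ _ _} _ _ _ _.

(** * Operator norm and invertibility *)

Section OperatorNorm.
Context {R : realType} {H : completeNormedModType R[i]} {ip : {dot H for Num.conj}}.
Context {A : set (H -> H)} {hA : von_neumann_algebra ip A}.
Context {A1 : (idfun : H -> H) <> 0}.
Hypothesis hH : hilbert_norm ip.
Local Notation V := (vnalg hA A1).
Local Notation rip := (re_ip ip).
Implicit Types (S T U : V).

Lemma vnopD S T u : (S + T) u = S u + T u. Proof. by []. Qed.
Lemma vnopN T u : (- T) u = - T u. Proof. exact: scaleN1r. Qed.
Lemma vnopB S T u : (S - T) u = S u - T u. Proof. by rewrite vnopD vnopN. Qed.
Lemma vnopM S T u : (S * T) u = S (T u). Proof. by []. Qed.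
Lemma vnopZ (c : R[i]) T u : (c *: T) u = c *: T u. Proof. by []. Qed.
Lemma vnop1 u : (1 : V) u = u. Proof. by []. Qed.
Lemma vnop0 u : (0 : V) u = 0. Proof. by []. Qed.
Lemma vnop_bounded T : bounded_op T. Proof. exact: (vn_bounded hA (vnopP T)). Qed.

Definition opnorm_le T (k : R) := forall u, nrm (T u) <= k * nrm u.

Definition invertible T := exists U, T * U = 1 /\ U * T = 1.

Lemma opnorm_le_ex T : exists2 k, 0 < k & opnorm_le T k.
Proof. by apply/(bounded_opP _ (vnop_linear _ _ T)); have [] := vnop_bounded T. Qed.

Lemma opnorm_le_trans T (k l : R) : k <= l -> opnorm_le T k -> opnorm_le T l.
Proof. by move=> kl Tk u; rewrite (le_trans (Tk u))// ler_wpM2r// nrm_ge0. Qed.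

Lemma opnorm_leD S T k l : opnorm_le S k -> opnorm_le T l -> opnorm_le (S + T) (k + l).
Proof. by move=> Sk Tl u; rewrite (le_trans (nrmD _ _))// mulrDl lerD. Qed.

Lemma opnorm_leN T k : opnorm_le T k -> opnorm_le (- T) k.
Proof. by move=> Tk u; rewrite vnopN nrmN. Qed.

Lemma opnorm_leB S T k l : opnorm_le S k -> opnorm_le T l -> opnorm_le (S - T) (k + l).
Proof. by move=> Sk /opnorm_leN; exact: opnorm_leD. Qed.

Lemma opnorm_leBC S T k : opnorm_le (S - T) k -> opnorm_le (T - S) k.
Proof. by move=> /opnorm_leN; rewrite opprB. Qed.

Lemma opnorm_leM S T (k l : R) :
  0 <= k -> opnorm_le S k -> opnorm_le T l -> opnorm_le (S * T) (k * l).
Proof.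
by move=> k0 Sk Tl u; rewrite vnopM (le_trans (Sk _))// -mulrA ler_wpM2l.
Qed.

Lemma opnorm_le1 : opnorm_le 1 1. Proof. by move=> u; rewrite mul1r. Qed.

Lemma opnorm_leX T (k : R) n : 0 <= k -> opnorm_le T k -> opnorm_le (T ^+ n) (k ^+ n).
Proof.
move=> k0 Tk; elim: n => [|n IH]; first by rewrite !expr0; exact: opnorm_le1.
by rewrite !exprS; exact: opnorm_leM.
Qed.

Lemma opnorm_leZ (r : R) T k : opnorm_le T k -> opnorm_le ((r%:C)%C *: T) (`|r| * k).
Proof.
move=> Tk u; rewrite vnopZ nrmZ normc_def/= expr0n addr0 sqrtr_sqr -mulrA.
by rewrite ler_wpM2l.
Qed.

Lemma opnorm_le_eq0 T : (forall e, 0 < e -> opnorm_le T e) -> T = 0.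
Proof.
move=> Te; apply: vnalg_ext => u; apply: nrm_eq0 => d d0.
have u0 : 0 < nrm u + 1 by rewrite ltr_wpDl// nrm_ge0.
rewrite (le_trans (Te _ (divr_gt0 d0 u0) u))// mulrAC ler_pdivrMr//.
by rewrite ler_pM2l// lerDl.
Qed.

(** Commutation with a bounded operator passes to norm limits, so that [A] is
    norm closed by the bicommutant property. *)
Lemma limit_in_vn (X : nat -> V) (Y : H -> H) :
  (forall e, 0 < e -> exists N, forall n, (N <= n)%N ->
    forall u, nrm (X n u - Y u) <= e * nrm u) -> A Y.
Proof.
move=> XY.
have YB e : 0 < e -> exists T : V, forall u, nrm (T u - Y u) <= e * nrm u.
  by move=> /XY[N hN]; exists (X N); exact: hN.
have lY : linear Y.
  move=> c u v; apply/eqP; rewrite -subr_eq0; apply/eqP/nrm_eq0 => d d0.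
  pose D := nrm (c *: u + v) + complex.Re `|c| * nrm u + nrm v + 1.
  have c0 : 0 <= complex.Re `|c| by rewrite -ler0c RRe_real// ger0_real.
  have D0 : 0 < D by rewrite ltr_wpDl// !addr_ge0 ?nrm_ge0// mulr_ge0 ?nrm_ge0.
  have [T hT] := YB _ (divr_gt0 d0 D0).
  have -> : Y (c *: u + v) - (c *: Y u + Y v) =
      - (T (c *: u + v) - Y (c *: u + v)) + c *: (T u - Y u) + (T v - Y v).
    have -> : T (c *: u + v) = c *: T u + T v by rewrite vnop_linear.
    by rewrite opprB scalerBr -addrA (addrACA (c *: T u)) -opprD subrKA.
  rewrite (le_trans (nrmD _ _))// (le_trans (lerD (nrmD _ _) (lexx _)))//.
  rewrite nrmN nrmZ (le_trans (lerD (lerD (hT _) (ler_wpM2l c0 (hT u))) (hT v)))//.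
  rewrite mulrCA -!mulrDr mulrAC ler_pdivrMr// ler_pM2l//.
  by rewrite /D lerDl.
have bY : bounded_op Y.
  split=> //; apply/(bounded_opP _ lY).
  have [T hT] := YB _ ltr01; have [K K0 TK] := opnorm_le_ex T.
  exists (1 + K) => [|u]; first by rewrite addr_gt0.
  by rewrite -[Y u](subrK (T u)) (le_trans (nrmD _ _))// nrmB mulrDl lerD.
rewrite -(vn_bicommutant hA); split=> // U [[lU cU] UA].
have [K K0 UK] := (bounded_opP _ lU).1 cU.
apply/funext => u /=; apply/eqP; rewrite -subr_eq0; apply/eqP/nrm_eq0 => d d0.
pose D := 2 * K * (nrm u) + 1.
have D0 : 0 < D by rewrite ltr_wpDl// !mulr_ge0 ?nrm_ge0// ltW.
have [T hT] := YB _ (divr_gt0 d0 D0).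
have TU : T (U u) = U (T u).
  by have := UA _ (vnopP T) => /(congr1 (fun f => f u)) /= ->.
have -> : Y (U u) - U (Y u) = - (T (U u) - Y (U u)) + U (T u - Y u).
  have -> : U (T u - Y u) = U (T u) - U (Y u).
    have := lU (-1) (Y u) (T u); rewrite !scaleN1r => h.
    by rewrite [T u - Y u]addrC h addrC.
  by rewrite TU opprB addrA subrK.
rewrite (le_trans (nrmD _ _))// nrmN.
rewrite (le_trans (lerD (hT _) (UK _)))//.
apply: (@le_trans _ _ (d / D * (K * nrm u) + K * (d / D * nrm u))).
  by rewrite lerD// ler_pM2l// divr_gt0.
have -> : d / D * (K * nrm u) + K * (d / D * nrm u) = d * (2 * K * nrm u) / D.
  by ring.
by rewrite ler_pdivrMr// ler_pM2l// lerDl.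
Qed.

Definition ncvg (X : nat -> V) T :=
  forall e, 0 < e -> exists N, forall n, (N <= n)%N -> opnorm_le (X n - T) e.

Lemma vn_complete (X : nat -> V) :
  (forall e, 0 < e -> exists N, forall m n, (N <= m)%N -> (N <= n)%N ->
     opnorm_le (X m - X n) e) ->
  exists Y, ncvg X Y.
Proof.
move=> hX.
have /choice[Y hY] : forall u, exists y, forall e, 0 < e ->
    exists N, forall n, (N <= n)%N -> nrm (X n u - y) <= e.
  move=> u; apply: nrm_complete => e e0.
  have u0 : 0 < nrm u + 1 by rewrite ltr_wpDl// nrm_ge0.
  have [N hN] := hX _ (divr_gt0 e0 u0); exists N => m n Nm Nn.
  rewrite -vnopB (le_trans (hN _ _ Nm Nn u))// mulrAC ler_pdivrMr// ler_pM2l//.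
  by rewrite lerDl.
have XY e : 0 < e -> exists N, forall n, (N <= n)%N ->
    forall u, nrm (X n u - Y u) <= e * nrm u.
  move=> e0; have [N hN] := hX _ e0; exists N => n Nn u.
  apply/ler_addgt0Pr => d d0; have [N' hN'] := hY u _ d0.
  rewrite -(subrKA (X (maxn N N') u)) (le_trans (nrmD _ _))//.
  by rewrite lerD ?hN' ?leq_maxr// -vnopB hN// leq_maxl.
exists (Vnalg hA A1 Y (limit_in_vn _ _ XY)) => e /XY[N hN].
by exists N => n Nn u; rewrite vnopB; exact: hN.
Qed.

Lemma invertible1 : invertible 1.
Proof. by exists 1; rewrite mulr1. Qed.

Lemma invertibleM S T : invertible S -> invertible T -> invertible (S * T).
Proof.
move=> [S' [SS' S'S]] [T' [TT' T'T]]; exists (T' * S').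
by rewrite mulrA -(mulrA S) TT' mulr1 SS' mulrA -(mulrA T') S'S mulr1 T'T.
Qed.

Lemma invertibleZ (c : R[i]) T : invertible (c *: T) -> invertible T.
Proof.
move=> [U [TU UT]]; exists (c *: U).
by rewrite -scalerAr -scalerAl in TU *; rewrite -scalerAr in UT; rewrite -scalerAl.
Qed.

Lemma invertible_comm S T : S * T = T * S -> invertible (S * T) -> invertible S.
Proof.
move=> ST [U [STU UST]]; exists (T * U); split; first by rewrite mulrA.
(* both one-sided inverses of S coincide *)
have e : U * T * S = 1 by rewrite -mulrA -ST.
by rewrite -[LHS]mul1r -{1}e -!mulrA (mulrA S T) (mulrA (S * T)) STU mul1r mulrA.
Qed.

(** Neumann series; the inverse belongs to [A], not only to the bounded
    operators, because [A] is norm closed. *)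
Lemma invertible_1B T (q : R) : 0 <= q -> q < 1 -> opnorm_le T q -> invertible (1 - T).
Proof.
move=> q0 q1 Tq; pose X n := \sum_(i < n) T ^+ i.
have X1 n : (1 - T) * X n = 1 - T ^+ n.
  by rewrite -opprB mulNr -subrX1 opprB.
have XC n : X n * (1 - T) = 1 - T ^+ n.
  rewrite -X1; apply: commrB; first exact: commr1.
  by apply/commr_sym/commr_sum => i _; apply: commrX.
have qn e : 0 < e -> exists N, forall n, (N <= n)%N -> q ^+ n <= e.
  move=> e0; have : (fun n => q ^+ n) @ \oo --> (0 : R).
    by apply: cvg_expr; rewrite ger0_norm.
  move=> /cvgrPdist_le/(_ _ e0)[N _ hN]; exists N => n /hN.
  by rewrite /= sub0r normrN ger0_norm// exprn_ge0.
have p0 : 0 < 1 - q by rewrite subr_gt0.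
have tail m n : (m <= n)%N -> opnorm_le (X n - X m) (q ^+ m / (1 - q)).
  move=> mn; suff : opnorm_le (X n - X m) ((q ^+ m - q ^+ n) / (1 - q)).
    by apply: opnorm_le_trans; rewrite ler_pM2r ?invr_gt0// gerBl exprn_ge0.
  elim: n mn => [|n IH] mn.
    by move: mn; rewrite leqn0 => /eqP -> u; rewrite !subrr mul0r vnop0 nrm0 mul0r.
  move: mn; rewrite leq_eqVlt => /predU1P[-> u|/IH mn].
    by rewrite !subrr mul0r vnop0 nrm0 mul0r.
  rewrite /X big_ord_recr/= addrAC.
  have := opnorm_leD _ _ _ _ mn (opnorm_leX _ _ n q0 Tq); apply: opnorm_le_trans.
  by rewrite exprS le_eqVlt; apply/orP; left; apply/eqP; field; rewrite gt_eqF.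
have [Y XY] : exists Y, ncvg X Y.
  apply: vn_complete => e e0; have [N hN] := qn _ (mulr_gt0 e0 p0).
  exists N => m n Nm Nn.
  wlog mn : m n Nm Nn / (m <= n)%N.
    move=> h; have [mn|/ltnW nm] := leqP m n; first exact: h.
    by apply: opnorm_leBC; exact: h.
  apply: opnorm_leBC; apply: opnorm_le_trans (tail _ _ mn).
  by rewrite ler_pdivrMr// hN.
have [K K0 TK] := opnorm_le_ex (1 - T).
have lim e : 0 < e -> exists n, opnorm_le (X n - Y) (e / (2 * K)) /\ q ^+ n <= e / 2.
  move=> e0; have [N hN] := XY _ (divr_gt0 e0 (mulr_gt0 (ltr0n _ 2) K0)).
  have [N' hN'] := qn _ (divr_gt0 e0 (ltr0n _ 2)).
  by exists (maxn N N'); split; [apply/hN/leq_maxl|apply/hN'/leq_maxr].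
exists Y; split; apply/eqP; rewrite -subr_eq0; apply/eqP/opnorm_le_eq0 => e e0;
    have [n [Xn Tn]] := lim _ e0.
  have -> : (1 - T) * Y - 1 = (1 - T) * (Y - X n) - T ^+ n.
    by rewrite mulrBr X1 -[RHS]addrA -opprD subrK.
  have h := opnorm_leM _ _ _ _ (ltW K0) TK (opnorm_leBC _ _ _ Xn).
  have := opnorm_leB _ _ _ _ h (opnorm_leX _ _ n q0 Tq).
  apply: opnorm_le_trans; rewrite [leRHS]splitr lerD//.
  by rewrite (_ : K * _ = e / 2)//; field; rewrite gt_eqF.
have -> : Y * (1 - T) - 1 = (Y - X n) * (1 - T) - T ^+ n.
  by rewrite mulrBl XC -[RHS]addrA -opprD subrK.
have k0 : 0 <= e / (2 * K) by rewrite divr_ge0 ?mulr_ge0 ?(ltW e0) ?(ltW K0).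
have h := opnorm_leM _ _ _ _ k0 (opnorm_leBC _ _ _ Xn) TK.
have := opnorm_leB _ _ _ _ h (opnorm_leX _ _ n q0 Tq).
apply: opnorm_le_trans; rewrite [leRHS]splitr lerD//.
by rewrite (_ : e / (2 * K) * K = e / 2)//; field; rewrite gt_eqF.
Qed.

(** If [C] bounds [T], then [|u - k T u| ^ 2 <= (1 - 2 k c + k ^ 2 C ^ 2) |u| ^ 2],
    and [k = c / C ^ 2] makes [1 - k T] a strict contraction. The lemma serves for
    [x - z] with real [z] beyond the bounds of [x], and for [i (x - z)], which is
    not self-adjoint, with nonreal [z]. *)
Lemma invertible_coercive T (c : R) : 0 < c ->
  (forall u, c * nrm u ^+ 2 <= rip (T u) u) -> invertible T.
Proof.
move=> c0 Tc; have [K K0 TK] := opnorm_le_ex T.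
pose C := K + c; have C0 : 0 < C by rewrite addr_gt0.
have TC : opnorm_le T C by apply: opnorm_le_trans TK; rewrite lerDl ltW.
pose k := c / C ^+ 2; pose q := Num.sqrt (1 - c ^+ 2 / C ^+ 2).
have q1' : 0 <= 1 - c ^+ 2 / C ^+ 2.
  rewrite subr_ge0 ler_pdivrMr ?exprn_gt0// mul1r lerXn2r ?nnegrE ?(ltW c0) ?(ltW C0)//.
  by rewrite lerDr ltW.
have q1 : q < 1.
  by rewrite -[ltRHS]sqrtr1 ltr_sqrt// gtrBl divr_gt0 ?exprn_gt0.
apply: (invertibleZ (k%:C)%C); rewrite -[_ *: T](subKr 1).
apply: (invertible_1B _ q) => //; first exact: sqrtr_ge0.
move=> u; rewrite -ler_sqr ?nnegrE ?mulr_ge0 ?sqrtr_ge0 ?nrm_ge0// exprMn sqr_sqrtr//.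
rewrite vnopB vnop1 vnopZ (nrm2 _ hH) (ripBl ip).
rewrite !(ripDr ip) !(ripNr ip) !(ripZl ip) !(ripZr ip).
rewrite -!(nrm2 _ hH) (ripC ip u).
have k0 : 0 < k by rewrite divr_gt0// exprn_gt0.
have h1 : k * (c * nrm u ^+ 2) <= k * rip (T u) u by rewrite ler_pM2l.
have h2 : k ^+ 2 * nrm (T u) ^+ 2 <= k ^+ 2 * (C * nrm u) ^+ 2.
  by rewrite ler_pM2l ?exprn_gt0// lerXn2r ?nnegrE ?nrm_ge0 ?mulr_ge0 ?nrm_ge0 ?(ltW C0).
have e1 : k * (c * nrm u ^+ 2) = c ^+ 2 / C ^+ 2 * nrm u ^+ 2 by rewrite /k; ring.
have e2 : k ^+ 2 * (C * nrm u) ^+ 2 = c ^+ 2 / C ^+ 2 * nrm u ^+ 2.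
  by rewrite /k; field; rewrite gt_eqF.
rewrite e1 in h1; rewrite e2 in h2.
move: (c ^+ 2 / C ^+ 2) (nrm u ^+ 2) (nrm (T u) ^+ 2) (rip (T u) u) h1 h2 => a b b' r.
by lra.
Qed.

End OperatorNorm.

(** * Norms of polynomials in a self-adjoint operator *)

Section SpectralBound.
Context {R : realType} {H : completeNormedModType R[i]} {ip : {dot H for Num.conj}}.
Context {A : set (H -> H)} {hA : von_neumann_algebra ip A}.
Context {A1 : (idfun : H -> H) <> 0}.
Hypothesis hH : hilbert_norm ip.
Local Notation V := (vnalg hA A1).
Local Notation rip := (re_ip ip).
Context (x : V).
Hypothesis sax : forall u v, rip (x u) v = rip u (x v).

Definition peval (p : {poly R}) : V := horner_alg x (map_poly (real_complex R) p).

Lemma pevalD p q : peval (p + q) = peval p + peval q.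
Proof. by rewrite /peval !rmorphD. Qed.
Lemma pevalB p q : peval (p - q) = peval p - peval q.
Proof. by rewrite /peval !rmorphB. Qed.
Lemma pevalM p q : peval (p * q) = peval p * peval q.
Proof. by rewrite /peval !rmorphM. Qed.
Lemma pevalC (k : R) : peval k%:P = (k%:C)%C *: 1.
Proof. by rewrite /peval map_polyC/= horner_algC. Qed.
Lemma pevalX : peval 'X = x.
Proof. by rewrite /peval map_polyX horner_algX. Qed.
Lemma pevalZ (k : R) p : peval (k *: p) = (k%:C)%C *: peval p.
Proof. by rewrite -mul_polyC pevalM pevalC -scalerAl mul1r. Qed.

Lemma vnop_sum (I : Type) (r : seq I) (F : I -> V) :
  vnop (\sum_(i <- r) F i) = \sum_(i <- r) vnop (F i).
Proof.
by elim/big_rec2: _ => // i f g _ <-.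
Qed.

Lemma vnop_exp n : vnop (x ^+ n) = iter n x.
Proof. by elim: n => // n IH; rewrite exprS; apply/funext => u; rewrite /= -IH. Qed.

Lemma peval_poly_op p : vnop (peval p) = poly_op p x.
Proof.
rewrite /peval -[in LHS](coefK p) poly_def rmorph_sum/= rmorph_sum/= /poly_op vnop_sum.
apply: eq_bigr => i _.
by rewrite map_polyZ/= map_polyXn linearZ/= rmorphXn/= horner_algX -vnop_exp.
Qed.

Lemma peval_sa p u v : rip (peval p u) v = rip u (peval p v).
Proof.
elim/poly_ind: p u v => [|p c IH] u v.
  by rewrite /peval !rmorph0 !vnop0 -(scale0r (0:H)) (ripZl ip 0) (ripZr ip 0) !mul0r.
rewrite pevalD pevalM pevalC pevalX !vnopD !vnopM !vnopZ !vnop1.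
rewrite ripDl ripDr ripZl ripZr IH.
rewrite sax; congr (_ + _).
have comm : x * peval p = peval p * x by rewrite -[x]pevalX -!pevalM mulrC.
by rewrite -[x (peval p v)]/((x * peval p) v) comm.
Qed.

(** Symmetry for the real inner product suffices: apply it to [i u] and [u]. *)
Lemma sa_Im0 (T : H -> H) : linear T -> (forall u v, rip (T u) v = rip u (T v)) ->
  forall u, complex.Im (ip (T u) u) = 0.
Proof.
move=> lT saT u; pose i : R[i] := Complex 0 1.
have Tiu : T (i *: u) = i *: T u.
  have T0 : T 0 = 0 by have := lT (-1) 0 0; rewrite scaleN1r oppr0 addr0 scaleN1r addNr.
  by have := lT i u 0; rewrite addr0 T0 addr0.
have := saT (i *: u) u; rewrite Tiu /re_ip !linearZl_LR/= (hermC ip u) expr0 mul1r.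
have key (z : R[i]) : complex.Re (i * z) = complex.Re (i * conjc z) -> complex.Im z = 0.
  by case: z => a b /=; lra.
exact: key.
Qed.

Definition specR : set R := [set t | ~ invertible (x - (t%:C)%C *: 1)].

Lemma specR_bounds (m M : R) :
  (forall u, m * nrm u ^+ 2 <= rip (x u) u <= M * nrm u ^+ 2) ->
  forall t, specR t -> m <= t <= M.
Proof.
move=> mM t; apply: contra_notP => /negP; rewrite negb_and -!ltNge => /orP[tm|Mt].
  apply: (invertible_coercive hH _ (m - t)); first by rewrite subr_gt0.
  move=> u; rewrite vnopB vnopZ vnop1 ripBl ripZl -(nrm2 ip hH) mulrBl lerD2r.
  by have /andP[] := mM u.
apply: (invertibleZ (((-1)%:C)%C : R[i])).
apply: (invertible_coercive hH _ (t - M)); first by rewrite subr_gt0.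
move=> u; rewrite vnopZ vnopB vnopZ vnop1 ripZl ripBl ripZl -(nrm2 ip hH).
rewrite mulN1r opprB mulrBl.
by rewrite lerD2l lerN2; have /andP[] := mM u.
Qed.

(** The imaginary part of [((x - z) u | u)] is [- Im z |u| ^ 2], hence
    [i (Im z) (x - z)] is coercive with constant [(Im z) ^ 2]. *)
Lemma invertible_sub_nonreal (z : R[i]) : complex.Im z != 0 -> invertible (x - z *: 1).
Proof.
move=> z0; set b := complex.Im z in z0.
apply: (invertibleZ (Complex 0 b)); apply: (invertible_coercive hH _ (b ^+ 2)).
  by rewrite exprn_even_gt0.
have E (c d : R[i]) v u : ip (c *: (v - d *: u)) u = c * (ip v u - d * ip u u).
  by rewrite linearZl_LR/= linearDl linearNl linearZl_LR.
move=> u; rewrite vnopZ vnopB vnopZ vnop1 /re_ip E.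
have := sa_Im0 _ (vnop_linear _ _ x) sax u; have nu := nrm2 ip hH u.
have : complex.Im (ip u u) = 0.
  by rewrite -hH nrmE -rmorphXn.
rewrite /re_ip in nu; case: (ip (x u) u) => r1 r2 /=; move: nu; rewrite /b.
case: (ip u u) z {z0 b} => n1 n2 [z1 z2] /= -> -> ->.
by rewrite le_eqVlt; apply/orP; left; apply/eqP; ring.
Qed.

Lemma invertible_horner (p : {poly R[i]}) : p != 0 ->
  (forall z, root p z -> invertible (x - z *: 1)) -> invertible (horner_alg x p).
Proof.
have [r ->] := closed_field_poly_normal p.
move=> p0 hp; have {p0}l0 : lead_coef p != 0.
  by apply: contraNneq p0 => ->; rewrite scale0r.
have {}hp z : z \in r -> invertible (x - z *: 1).
  by move=> zr; apply: hp; rewrite rootZ// root_prod_XsubC.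
apply: (invertibleZ (lead_coef p)^-1).
rewrite -mul_polyC rmorphM/= horner_algC -scalerAl mul1r scalerA mulVf// scale1r.
elim: r hp => [|z r IH] hp; first by rewrite big_nil rmorph1; exact: invertible1.
rewrite big_cons rmorphM rmorphB/= horner_algX horner_algC; apply: invertibleM.
  by apply: hp; rewrite mem_head.
by apply: IH => z' z'r; apply: hp; rewrite inE z'r orbT.
Qed.

Lemma invertible_peval (q : {poly R}) : q != 0 ->
  (forall t, specR t -> 0 < q.[t]) -> invertible (peval q).
Proof.
move=> q0 hq; apply: invertible_horner => [|z]; first by rewrite map_poly_eq0.
have [|/invertible_sub_nonreal//] := eqVneq (complex.Im z) 0.
case: z => t b /= ->; rewrite -[Complex t 0]/((t%:C)%C) /root horner_map/= => qt.
apply: contrapT => /hq; rewrite -ltcR; move/eqP: qt => ->.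
by rewrite ltxx.
Qed.

(** If [U] inverts [Q = w ^ 2 - p(x) ^ 2] and is bounded by [K], then
    [|u| ^ 2 <= K ^ 2 |Q u| ^ 2 <= K ^ 2 w ^ 2 (w ^ 2 |u| ^ 2 - |p(x) u| ^ 2)], which
    is a bound for [p(x)] strictly better than [w]. *)
Lemma norm_improve (p : {poly R}) (w : R) : 0 < w -> opnorm_le (peval p) w ->
  invertible (peval ((w ^+ 2)%:P - p * p)) ->
  exists w', [/\ 0 <= w', w' < w & opnorm_le (peval p) w'].
Proof.
move=> w0 Pw [U [_ UQ]]; have [K K0 UK] := opnorm_le_ex U.
set P := peval p in Pw *; set Q := peval _ in UQ.
pose k := (K ^+ 2 * w ^+ 2)^-1.
have k0 : 0 < k by rewrite invr_gt0 mulr_gt0 ?exprn_gt0.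
have main u : nrm (P u) ^+ 2 <= (w ^+ 2 - k) * nrm u ^+ 2.
  have h1 : nrm u ^+ 2 <= K ^+ 2 * nrm (Q u) ^+ 2.
    rewrite -exprMn lerXn2r ?nnegrE ?nrm_ge0 ?mulr_ge0 ?nrm_ge0 ?(ltW K0)//.
    have -> : nrm u = nrm ((U * Q) u) by rewrite UQ.
    exact: UK.
  have h2 : nrm (P (P u)) ^+ 2 <= w ^+ 2 * nrm (P u) ^+ 2.
    by rewrite -exprMn lerXn2r ?nnegrE ?nrm_ge0 ?mulr_ge0 ?nrm_ge0 ?(ltW w0).
  have h3 : nrm (Q u) ^+ 2 = w ^+ 2 * (w ^+ 2 * nrm u ^+ 2)
      - 2 * w ^+ 2 * nrm (P u) ^+ 2 + nrm (P (P u)) ^+ 2.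
    rewrite /Q pevalB pevalC pevalM -/P vnopB vnopZ vnop1 vnopM.
    rewrite (nrm2 _ hH) (ripBl ip).
    rewrite !(ripDr ip) !(ripNr ip) !(ripZl ip) !(ripZr ip).
    have e : rip (P (P u)) u = nrm (P u) ^+ 2 by rewrite (nrm2 _ hH) /P [LHS]peval_sa.
    rewrite (ripC ip u (P (P u))) e -!(nrm2 _ hH).
    by ring.
  have h4 : nrm u ^+ 2 <= K ^+ 2 * (w ^+ 2 * (w ^+ 2 * nrm u ^+ 2 - nrm (P u) ^+ 2)).
    rewrite (le_trans h1)// ler_pM2l ?exprn_gt0// h3.
    by move: (nrm (P (P u)) ^+ 2) h2 => a; lra.
  rewrite mulrBl lerBrDl -lerBrDr addrC /k.
  rewrite [_^-1 * _]mulrC ler_pdivrMr ?mulr_gt0 ?exprn_gt0//.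
  by rewrite (le_trans h4)// mulrA mulrC addrC.
exists (Num.sqrt (Num.max 0 (w ^+ 2 - k))); split.
- exact: sqrtr_ge0.
- rewrite -[ltRHS](ger0_norm (ltW w0)) -sqrtr_sqr ltr_sqrt ?exprn_gt0//.
  by rewrite gt_max exprn_gt0//= gtrBl.
move=> u; rewrite -ler_sqr ?nnegrE ?mulr_ge0 ?sqrtr_ge0 ?nrm_ge0// exprMn.
rewrite sqr_sqrtr ?le_max ?lexx// (le_trans (main u))// ler_wpM2r ?exprn_ge0 ?nrm_ge0//.
by rewrite le_max lexx orbT.
Qed.

Lemma opnorm_le_inf (T : V) (S : set R) : S !=set0 ->
  (forall k, S k -> opnorm_le T k) -> opnorm_le T (reals.inf S).
Proof.
move=> S0 ST u; have [u0|u0] := eqVneq (nrm u) 0.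
  by have [k Sk] := S0; have := ST _ Sk u; rewrite u0 !mulr0.
have un : 0 < nrm u by rewrite lt_def u0 nrm_ge0.
rewrite -ler_pdivrMr//; apply: lb_le_inf => // k /ST Tk.
by rewrite ler_pdivrMr.
Qed.

Lemma opnorm_ex (p : {poly R}) : exists w, [/\ 0 <= w, opnorm_le (peval p) w &
  forall w', 0 <= w' -> opnorm_le (peval p) w' -> w <= w'].
Proof.
pose S := [set k | 0 <= k /\ opnorm_le (peval p) k].
have S0 : S !=set0.
  by have [k k0 pk] := opnorm_le_ex (peval p); exists k; split=> //; exact: ltW.
have lS : lbound S 0 by move=> k [].
exists (reals.inf S); split.
- exact: lb_le_inf.
- by apply: opnorm_le_inf => // k [].
by move=> w' w'0 pw'; apply: ge_inf; [exists 0|split].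
Qed.

(** Without a spectral value even [w ^ 2 - x ^ 2] would be invertible for the
    norm [w] of [x]. Nonemptiness is what keeps [w ^ 2 - p ^ 2] from being the
    zero polynomial in the general bound. *)
Lemma specR_neq0 : specR !=set0.
Proof.
apply/set0P/eqP => s0.
have [w [w0 xw wmin]] := opnorm_ex 'X.
have [w00|wn0] := eqVneq w 0.
  have x0 : x = 0.
    apply: opnorm_le_eq0 => e e0; rewrite -[x]pevalX; apply: opnorm_le_trans xw.
    by rewrite w00 ltW.
  have : specR 0.
    rewrite /specR/= x0 scale0r subr0 => -[U [U0 _]].
    by move/eqP: U0; rewrite mul0r eq_sym oner_eq0.
  by rewrite s0.
have wp : 0 < w by rewrite lt_def wn0.
have qi : invertible (peval ((w ^+ 2)%:P - 'X * 'X)).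
  apply: invertible_peval => [|t]; last by rewrite s0.
  by rewrite -oppr_eq0 opprB -expr2 -size_poly_eq0 size_XnsubC.
have [w' [w'0 w'w pw']] := norm_improve _ _ wp xw qi.
by have := wmin _ w'0 pw'; rewrite leNgt w'w.
Qed.

Lemma peval_norm_le (p : {poly R}) (s : R) :
  (forall t, specR t -> `|p.[t]| <= s) -> opnorm_le (peval p) s.
Proof.
move=> ps; have [t0 st0] := specR_neq0.
have s0 : 0 <= s by rewrite (le_trans _ (ps _ st0)).
have [w [w0 pw wmin]] := opnorm_ex p.
have [ws|sw] := leP w s; first exact: opnorm_le_trans pw.
have wp : 0 < w by rewrite (le_lt_trans s0).
have hq t : specR t -> 0 < ((w ^+ 2)%:P - p * p).[t].
  move=> /ps pt; rewrite hornerD hornerN hornerM hornerC -expr2 subr_gt0.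
  rewrite -(real_normK (num_real p.[t])) ltrXn2r//= ?nnegrE//.
  exact: le_lt_trans sw.
have qi : invertible (peval ((w ^+ 2)%:P - p * p)).
  apply: invertible_peval => //; apply/eqP => q0.
  by have := hq _ st0; rewrite q0 horner0 ltxx.
have [w' [w'0 w'w pw']] := norm_improve _ _ wp pw qi.
by have := wmin _ w'0 pw'; rewrite leNgt w'w.
Qed.

End SpectralBound.

(** * Continuous functional calculus *)

Lemma uniform_seqP {R : realType} (D : set R) (F : nat -> R -> R) (f : R -> R) :
  {uniform D, F @ \oo --> f} <->
  (forall e, 0 < e -> exists N, forall n, (N <= n)%N ->
     forall t, D t -> `|F n t - f t| <= e).
Proof.
split=> [h e e0|h P /uniform_nbhs[E [/= entE EP]]].
  have : nbhs (f : {uniform` D -> R}) [set g | forall t, D t -> `|g t - f t| <= e].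
    apply/uniform_nbhs; exists [set xy | ball xy.1 e xy.2]; split.
      exact: entourage_ball (PosNum e0).
    by move=> g /= hg t Dt; rewrite distrC ltW//; exact: hg.
  by move=> /h[N _ hN]; exists N => n /hN.
move: entE; rewrite -entourage_ballE => -[e e0 eE].
have [N hN] := h _ (divr_gt0 e0 (ltr0n _ 2)).
exists N => // n /= Nn; apply: EP => t Dt; apply: eE => /=.
rewrite /ball/= distrC (le_lt_trans (hN _ Nn _ Dt))//.
by rewrite ltr_pdivrMr// ltr_pMr// ltr1n.
Qed.

Lemma archi_inv {R : realType} (e : R) : 0 < e ->
  exists N, forall n, (N <= n)%N -> n.+1%:R^-1 <= e.
Proof.
move=> e0; exists (Num.truncn e^-1) => n Nn.
rewrite -[leRHS]invrK lef_pV2 ?posrE ?invr_gt0 ?ltr0n//.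
by rewrite ltW// (lt_le_trans (truncnS_gt _))// ler_nat.
Qed.

Section FunctionalCalculus.
Context {R : realType} {H : completeNormedModType R[i]} {ip : {dot H for Num.conj}}.
Context {A : set (H -> H)} {hA : von_neumann_algebra ip A}.
Context {A1 : (idfun : H -> H) <> 0}.
Hypothesis hH : hilbert_norm ip.
Local Notation V := (vnalg hA A1).
Local Notation rip := (re_ip ip).
Context (x : V).
Hypothesis sax : forall u v, rip (x u) v = rip u (x v).
Context (M : R).
Hypothesis sM : forall t, specR x t -> `|t| <= M.
Local Notation sigma := (specR x).
Local Notation peval := (peval x).
Implicit Types (f g : R -> R) (Y Z : V).

Let peval_le := peval_norm_le hH x sax.

(** If [0 <= p <= K] on [sigma] then [|K - p| <= K] there, so [K - p(x)] has norm
    at most [K] and [p(x)] is positive. *)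
Lemma peval_ge0 p : (forall t, sigma t -> 0 <= p.[t]) ->
  forall u, 0 <= rip (peval p u) u.
Proof.
move=> p0 u; have [K K0 pK] := polyapprox_bounded _ _ sM _ (polyapprox_poly sigma p).
have : opnorm_le (peval (K%:P - p)) K.
  apply: peval_le => t st; rewrite hornerD hornerN hornerC ger0_norm.
    by rewrite gerBl p0.
  by rewrite subr_ge0 (le_trans (ler_norm _))// pK.
move=> /(_ u); rewrite pevalB pevalC vnopB vnopZ vnop1 => h.
have := cauchy_schwarz _ hH ((K%:C)%C *: u - peval p u) u.
rewrite ripBl ripZl -(nrm2 _ hH) ler_norml => /andP[_ h2].
have : nrm ((K%:C)%C *: u - peval p u) * nrm u <= K * nrm u * nrm u.
  by rewrite ler_wpM2r// nrm_ge0.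
by rewrite -mulrA -expr2; lra.
Qed.

(** Both approximations use the same polynomial, so that sums and bounds can be
    handled without choosing sequences. *)
Definition fcalc f Y := forall e, 0 < e -> exists p,
  (forall t, sigma t -> `|p.[t] - f t| <= e) /\ opnorm_le (peval p - Y) e.

Lemma fcalc_ex f : polyapprox sigma f -> exists Y, fcalc f Y.
Proof.
move=> hf; have /choice[p hp] : forall n : nat, exists p : {poly R},
    forall t, sigma t -> `|p.[t] - f t| <= n.+1%:R^-1.
  by move=> n; apply: hf; rewrite invr_gt0 ltr0n.
have [Y pY] : exists Y, ncvg (fun n => peval (p n)) Y.
  apply: vn_complete => e e0; have [N hN] := archi_inv _ (divr_gt0 e0 (ltr0n _ 2)).
  exists N => m n Nm Nn; rewrite -pevalB; apply: peval_le => t st.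
  rewrite hornerD hornerN -(subrKA (f t)) [leRHS]splitr.
  rewrite (le_trans (ler_normD _ _))// lerD//.
    by rewrite (le_trans (hp _ _ st))// hN.
  by rewrite distrC (le_trans (hp _ _ st))// hN.
exists Y => e e0; have [N hN] := archi_inv _ e0; have [N' hN'] := pY _ e0.
exists (p (maxn N N')); split; last by apply/hN'/leq_maxr.
by move=> t st; rewrite (le_trans (hp _ _ st))// hN// leq_maxl.
Qed.

Lemma fcalc_uniq f Y Z : fcalc f Y -> fcalc f Z -> Y = Z.
Proof.
move=> hY hZ; apply/eqP; rewrite -subr_eq0; apply/eqP/opnorm_le_eq0 => e e0.
have e4 : 0 < e / 4 by rewrite divr_gt0.
have [p [pf pY]] := hY _ e4; have [q [qf qZ]] := hZ _ e4.
have -> : Y - Z = - (peval p - Y) + (peval (p - q) + (peval q - Z)).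
  by rewrite pevalB opprB [peval p - peval q + _]addrA subrK addrA subrK.
have pq : opnorm_le (peval (p - q)) (e / 4 + e / 4).
  apply: peval_le => t st; rewrite hornerD hornerN -(subrKA (f t)).
  by rewrite (le_trans (ler_normD _ _))// lerD ?pf// distrC qf.
have h := opnorm_leD _ _ _ _ (opnorm_leN _ _ pY) (opnorm_leD _ _ _ _ pq qZ).
apply: opnorm_le_trans h.
by lra.
Qed.

Lemma fcalc_lin (k : R) f g Y Z : fcalc f Y -> fcalc g Z ->
  fcalc (fun t => k * f t + g t) ((k%:C)%C *: Y + Z).
Proof.
move=> hY hZ e e0; have k0 : 0 < `|k| + 1 by rewrite ltr_wpDl.
have [p [pf pY]] := hY _ (divr_gt0 (divr_gt0 e0 (ltr0n _ 2)) k0).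
have [q [qf qZ]] := hZ _ (divr_gt0 e0 (ltr0n _ 2)).
have ke : `|k| * (e / 2 / (`|k| + 1)) <= e / 2.
  rewrite mulrA ler_pdivrMr// mulrC ler_pM2l ?divr_gt0//.
  by rewrite lerDl.
exists (k *: p + q); split=> [t st|].
  rewrite hornerD hornerZ opprD addrACA -mulrBr (le_trans (ler_normD _ _))//.
  rewrite [leRHS]splitr lerD ?qf// normrM (le_trans _ ke)//.
  by rewrite ler_wpM2l ?pf.
rewrite pevalD pevalZ opprD addrACA -scalerBr.
apply: opnorm_le_trans (opnorm_leD _ _ _ _ (opnorm_leZ k _ _ pY) qZ).
by rewrite [leRHS]splitr lerD.
Qed.

Lemma fcalc_poly p : fcalc (fun t => p.[t]) (peval p).
Proof.
move=> e e0; exists p; split=> [t _|u]; first by rewrite subrr normr0 ltW.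
by rewrite subrr vnop0 nrm0 mulr_ge0 ?nrm_ge0 ?ltW.
Qed.

Lemma opnorm_le_rip (T : V) k u v :
  opnorm_le T k -> `|rip (T u) v| <= k * nrm u * nrm v.
Proof.
by move=> Tk; rewrite (le_trans (cauchy_schwarz _ hH _ _))// ler_wpM2r ?nrm_ge0.
Qed.

Lemma fcalc_sa f Y : fcalc f Y -> forall u v, rip (Y u) v = rip u (Y v).
Proof.
move=> hY u v; apply/eqP; rewrite -subr_eq0 -normr_le0.
apply/ler_addgt0Pr => d d0; rewrite add0r.
pose D := 2 * nrm u * nrm v + 1.
have D0 : 0 < D by rewrite ltr_wpDl// !mulr_ge0 ?nrm_ge0.
have [p [_ pY]] := hY _ (divr_gt0 d0 D0).
have h1 := opnorm_le_rip _ _ u v pY; have h2 := opnorm_le_rip _ _ v u pY.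
rewrite vnopB ripBl (peval_sa _ sax) in h1.
rewrite vnopB ripBl ripC (ripC ip _ u) in h2.
rewrite -(subrKA (rip u (peval p v))) (le_trans (ler_normD _ _))// distrC.
rewrite (le_trans (lerD h1 h2))//.
rewrite (_ : _ + _ = d * (2 * nrm u * nrm v) / D); last by ring.
by rewrite ler_pdivrMr// ler_pM2l// lerDl.
Qed.

Lemma fcalc_ge0 f Y : (forall t, sigma t -> 0 <= f t) -> fcalc f Y -> pos_op ip Y.
Proof.
move=> f0 hY u; rewrite lecE /= (sa_Im0 _ (vnop_linear _ _ Y) (fcalc_sa _ _ hY)) eqxx/=.
apply/ler_addgt0Pr => d d0.
pose D := 2 * nrm u ^+ 2 + 1.
have D0 : 0 < D by rewrite ltr_wpDl// mulr_ge0// exprn_ge0// nrm_ge0.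
have e0 : 0 < d / D by rewrite divr_gt0.
have [p [pf pY]] := hY _ e0.
have : forall t, sigma t -> 0 <= (p + (d / D)%:P).[t].
  move=> t st; have := pf _ st; rewrite ler_norml hornerD hornerC => /andP[h _].
  by have := f0 _ st; lra.
move=> /peval_ge0/(_ u).
rewrite pevalD pevalC vnopD vnopZ vnop1 ripDl ripZl -(nrm2 _ hH) => h1.
have := opnorm_le_rip _ _ u u pY; rewrite vnopB ripBl -mulrA -expr2 => h2.
have h3 : d / D * (2 * nrm u ^+ 2) <= d.
  by rewrite mulrAC ler_pdivrMr// ler_pM2l// lerDl.
move: h2; rewrite ler_norml => /andP[_ h2].
rewrite -/(rip (Y u) u).
by lra.
Qed.

(** If [f t > 0] while [f(x) = 0], a polynomial [p] close to [f] satisfies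
    [p t > norm of p(x)]; then [p t - p(x)] is coercive, hence invertible, and so
    is its factor [x - t]. *)
Lemma fcalc_eq0 f t : fcalc f 0 -> sigma t -> 0 <= f t -> f t = 0.
Proof.
move=> hf st; rewrite le_eqVlt => /predU1P[//|ft0]; exfalso.
have [p [pf]] := hf _ (divr_gt0 ft0 (ltr0n _ 4)); rewrite subr0 => pb.
have pt : 3 / 4 * f t <= p.[t].
  by have := pf _ st; rewrite ler_norml => /andP[h _]; lra.
have : invertible (peval (p.[t]%:P - p)).
  apply: (invertible_coercive hH _ (f t / 2)) => [|u]; first by rewrite divr_gt0.
  rewrite pevalB pevalC vnopB vnopZ vnop1 ripBl ripZl -(nrm2 _ hH).
  have := opnorm_le_rip _ _ u u pb; rewrite -mulrA -expr2 ler_norml => /andP[_ h].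
  have : 3 / 4 * f t * nrm u ^+ 2 <= p.[t] * nrm u ^+ 2.
    by rewrite ler_wpM2r// exprn_ge0// nrm_ge0.
  by move: (nrm u ^+ 2) (rip _ _) h => a b; lra.
have /factor_theorem[q hq] : root (p.[t]%:P - p) t.
  by rewrite /root hornerD hornerN hornerC subrr.
rewrite hq mulrC pevalM => /invertible_comm iq; apply: st.
have -> : x - (t%:C)%C *: 1 = peval ('X - t%:P) by rewrite pevalB pevalX pevalC.
by apply: iq; rewrite -!pevalM mulrC.
Qed.

End FunctionalCalculus.

(** * The trace *)

Section Trace.
Context {R : realType} {H : completeNormedModType R[i]} {ip : {dot H for Num.conj}}.
Context {A : set (H -> H)} {tr : (H -> H) -> R[i]}.
Context {hA : von_neumann_algebra ip A}.
Hypothesis hH : hilbert_norm ip.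
Hypothesis htr : faithful_normal_tracial_state ip A tr.

Lemma idfun_neq0 : (idfun : H -> H) <> 0.
Proof.
move=> id0; have Ai := vn_id hA.
have := tr_linear htr (-1) Ai Ai; rewrite scaleN1r addNr mulN1r addNr -id0 (tr_id htr).
by move/eqP; rewrite oner_eq0.
Qed.

Local Notation V := (vnalg hA idfun_neq0).
Local Notation rip := (re_ip ip).
Implicit Types (S T : V).

Definition re_tr T : R := complex.Re (tr T).

Lemma re_trD S T : re_tr (S + T) = re_tr S + re_tr T.
Proof.
have := tr_linear htr 1 (vnopP S) (vnopP T); rewrite scale1r mul1r /re_tr => ->.
exact: raddfD.
Qed.

Lemma re_trZ (k : R) T : re_tr ((k%:C)%C *: T) = k * re_tr T.
Proof.
have := tr_linear htr (k%:C)%C (vnopP T) (vn_zero hA).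
have := tr_linear htr (-1) (vn_zero hA) (vn_zero hA).
rewrite scaleN1r addNr mulN1r addNr => ->; rewrite !addr0 /re_tr => ->.
by case: (tr _) => a b /=; rewrite mul0r subr0.
Qed.

Lemma re_trN T : re_tr (- T) = - re_tr T.
Proof. by have := re_trZ (-1) T; rewrite rmorphN1 scaleN1r mulN1r. Qed.

Lemma re_tr1 : re_tr 1 = 1.
Proof. by rewrite /re_tr (tr_id htr). Qed.

Lemma re_tr_ge0 T : pos_op ip T -> 0 <= re_tr T.
Proof. by move=> /(tr_ge0 htr (vnopP T)); rewrite lecE => /andP[]. Qed.

Lemma re_tr_faithful T : pos_op ip T -> re_tr T = 0 -> T = 0.
Proof.
move=> pT tT; have tr0 := tr_ge0 htr (vnopP T) pT.
apply: vnalg_ext => u; rewrite (tr_faithful htr (vnopP T) pT)//.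
move: tr0 tT; rewrite lecE /re_tr; case: (tr _) => a b /= /andP[/eqP -> _] ->.
by [].
Qed.

Section SpectralMean.
Context (x : V) (M : R).
Hypothesis sax : forall u v, rip (x u) v = rip u (x v).
Hypothesis sM : forall t, specR x t -> `|t| <= M.

Definition spectral_mean (f : R -> R) : R := re_tr (xget 0 (fcalc x f)).

Lemma spectral_meanE f Y : fcalc x f Y -> spectral_mean f = re_tr Y.
Proof.
move=> fY; rewrite /spectral_mean; case: xgetP => [Z _ fZ|/(_ Y)//].
by rewrite (fcalc_uniq hH _ sax _ _ _ fY fZ).
Qed.

Lemma spectral_mean_faithful : faithful_mean (specR x) spectral_mean.
Proof.
have ex f : polyapprox (specR x) f -> exists Y, fcalc x f Y.
  exact: (fcalc_ex hH _ sax).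
split.
- move=> k f g /ex[Y fY] /ex[Z gZ].
  rewrite (spectral_meanE _ _ fY) (spectral_meanE _ _ gZ).
  by rewrite (spectral_meanE _ _ (fcalc_lin _ k _ _ _ _ fY gZ)) re_trD re_trZ.
- move=> f /ex[Y fY] f0; rewrite (spectral_meanE _ _ fY); apply: re_tr_ge0.
  exact: (fcalc_ge0 hH _ sax _ sM _ _ f0 fY).
- have := fcalc_poly x 1%:P; rewrite pevalC scale1r => h.
  have -> : (fun=> 1) = (fun t : R => (1%:P).[t]) by apply/funext => t; rewrite hornerC.
  by rewrite (spectral_meanE _ _ h) re_tr1.
move=> f /ex[Y fY] f0; rewrite (spectral_meanE _ _ fY) => Y0 t st.
have YY : Y = 0.
  by apply: re_tr_faithful => //; exact: (fcalc_ge0 hH _ sax _ sM _ _ f0 fY).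
apply: (fcalc_eq0 hH _ _ _ _ st (f0 _ st)) => //.
by rewrite -YY.
Qed.

End SpectralMean.

Lemma invertible_inP T : invertible_in A T <-> invertible T.
Proof.
split=> [[U AU [TU UT]]|[U [TU UT]]].
  by exists (Vnalg hA _ U AU); split; apply: vnalg_ext => u;
    [rewrite -[RHS]/(idfun u) -TU|rewrite -[RHS]/(idfun u) -UT].
exists U; first exact: vnopP.
by split; [rewrite -[RHS]/(vnop (1 : V)) -TU|rewrite -[RHS]/(vnop (1 : V)) -UT].
Qed.

Lemma spectrumP T z : spectrum A T z <-> ~ invertible (T - z *: 1).
Proof.
rewrite /spectrum/= -invertible_inP.
suff -> : (T - z *: 1 : V) = (T : H -> H) - z *: idfun :> (H -> H) by [].
by apply/funext => u; rewrite vnopB.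
Qed.

Lemma peval_comp (x y : V) q p : y = peval x q -> peval y p = peval x (p \Po q).
Proof.
move=> yq; elim/poly_ind: p => [|p c IH]; first by rewrite comp_poly0 /peval !rmorph0.
rewrite pevalD pevalM pevalC pevalX IH comp_polyD comp_polyM comp_polyX comp_polyC.
by rewrite pevalD pevalM pevalC -yq.
Qed.

(** Polynomials in [x + eps] are polynomials in [x], and the spectrum is shifted
    accordingly. Existence of [f(x + eps)] is needed first, for the chosen
    operator to have the defining property. *)
Lemma fun_calc_shift (x : V) (eps : R) (f : R -> R)
    (sax : forall u v, rip (x u) v = rip u (x v)) :
  polyapprox (specR x) (fun t => f (t + eps)) ->
  complex.Re (tr (fun_calc A ((x : H -> H) + (eps%:C)%C *: idfun) f)) =
    spectral_mean x (fun t => f (t + eps)).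
Proof.
move=> hf; pose y : V := x + (eps%:C)%C *: 1.
have -> : (x : H -> H) + (eps%:C)%C *: idfun = y by [].
have yE : y = peval x ('X + eps%:P) by rewrite pevalD pevalX pevalC.
have xE : x = peval y ('X - eps%:P) by rewrite pevalB pevalX pevalC addrK.
have spE t : specR x t <-> spectrum A y (((t + eps)%:C)%C : R[i]).
  rewrite spectrumP /y rmorphD/= scalerDl opprD addrACA subrr addr0.
  by [].
have [Y [AY fY]] : exists Y : H -> H, A Y /\ is_fun_calc A y f Y.
  have [Y fY] := fcalc_ex hH _ sax _ hf; exists Y; split; first exact: vnopP.
  have /choice[p hp] : forall n : nat, exists p : {poly R},
      (forall t, specR x t -> `|p.[t] - f (t + eps)| <= n.+1%:R^-1) /\
      opnorm_le (peval x p - Y) n.+1%:R^-1.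
    by move=> n; apply: fY; rewrite invr_gt0 ltr0n.
  exists (fun n => p n \Po ('X - eps%:P)); split.
    apply/uniform_seqP => e e0; have [N hN] := archi_inv _ e0.
    exists N => n Nn t /= st; have [h _] := hp n.
    have := h (t - eps); rewrite spE subrK => /(_ st) h'.
    rewrite horner_comp hornerD hornerX hornerN hornerC (le_trans h')//.
    exact: hN.
  move=> e e0; have [er e'0] : ((complex.Re e)%:C)%C = e /\ 0 < complex.Re e.
    by split; rewrite -?ltcR RRe_real// gtr0_real.
  have [N hN] := archi_inv _ e'0; exists N => // n Nn u.
  rewrite -peval_poly_op -(peval_comp _ _ _ _ xE) -er !nrmE -rmorphM lecR.
  have [_ h] := hp n; have := h u; rewrite vnopB => /le_trans; apply.
  by rewrite ler_wpM2r ?nrm_ge0// hN.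
have {Y AY fY} : is_fun_calc A y f (fun_calc A y f).
  exact: (@getI _ (is_fun_calc A y f) Y fY).
move=> [p [/uniform_seqP pf pY]]; set Y := fun_calc _ _ _ in pY *.
have pY' e : 0 < e -> exists N, forall n, (N <= n)%N ->
    forall u, nrm (peval y (p n) u - Y u) <= e * nrm u.
  move=> e0; have ec0 : 0 < (e%:C)%C :> R[i] by rewrite ltcR.
  have [N _ hN] := pY _ ec0; exists N => n /hN h u.
  by have := h u; rewrite -peval_poly_op !nrmE -rmorphM lecR.
have AY := limit_in_vn _ _ pY'.
rewrite -[LHS]/(re_tr (Vnalg hA _ Y AY)); apply/esym/(spectral_meanE _ sax).
move=> e e0; have [N hN] := pf _ e0; have [N' hN'] := pY' _ e0.
exists (p (maxn N N') \Po ('X + eps%:P)); split=> [t /spE st|u].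
  by rewrite horner_comp hornerD hornerX hornerC; apply: hN => //; exact: leq_maxl.
rewrite -(peval_comp _ _ _ _ yE) vnopB; apply: hN'; exact: leq_maxr.
Qed.

(** If [c b = 1] with [c = (bs b)^-1 bs], then [q = 1 - b c] is a self-adjoint
    idempotent, hence positive, and its trace is [tr 1 - tr (c b) = 0]; so [q = 0]
    by faithfulness and [c] is a two-sided inverse. *)
Lemma invertible_gram (b bs : V) : (forall u v, rip (b u) v = rip u (bs v)) ->
  invertible (bs * b) -> invertible b.
Proof.
move=> adjb [U [xU Ux]]; pose c := U * bs.
have cb : c * b = 1 by rewrite /c -mulrA.
have bC u v : rip (bs u) v = rip u (b v) by rewrite (ripC ip) -adjb (ripC ip).
have Usa u v : rip (U u) v = rip u (U v).
  have e (w : H) : w = (bs * b) (U w) by rewrite -vnopM xU.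
  by rewrite {1}(e v) vnopM -adjb -bC -vnopM -e.
pose q := 1 - b * c.
have qsa u v : rip (q u) v = rip u (q v).
  rewrite !vnopB !vnop1 ripBl ripDr ripNr; congr (_ - _).
  by rewrite /c !vnopM adjb Usa bC.
have qq : q * q = q.
  rewrite /q mulrBl mul1r mulrBr mulr1 -mulrA (mulrA c) cb mul1r.
  by rewrite subrr subr0.
have q0 : q = 0.
  apply: re_tr_faithful => [u|].
    rewrite lecE/= (sa_Im0 _ (vnop_linear _ _ q) qsa) eqxx/= -/(rip (q u) u).
    by rewrite -qq vnopM qsa -(nrm2 _ hH) exprn_ge0 ?nrm_ge0.
  rewrite /q re_trD re_trN.
  have -> : re_tr (b * c) = re_tr (c * b).
    by rewrite /re_tr; congr complex.Re; exact: (tr_tracial htr (vnopP b) (vnopP c)).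
  by rewrite cb subrr.
by exists c; split=> //; apply/esym/eqP; rewrite -subr_eq0 -/q q0.
Qed.

End Trace.

Lemma adj_in_vn (R : realType) (H : completeNormedModType R[i])
    (ip : {dot H for Num.conj}) (A : set (H -> H)) :
  von_neumann_algebra ip A ->
  forall T, A T -> A (adj ip T) /\ is_adjoint ip T (adj ip T).
Proof.
move=> hA T AT; have [T' AT' TT'] := vn_adj hA AT.
have adjT : is_adjoint ip T (adj ip T) by exact: getI TT'.
suff -> : adj ip T = T' by [].
apply/funext => v; apply/eqP; rewrite -subr_eq0 -(dnorm_eq0 ip).
have h u w z : ip u (w - z) = ip u w - ip u z by rewrite raddfB.
by rewrite h -adjT -TT' subrr.
Qed.

Theorem theorem2p6 (R : realType) (H : completeNormedModType R[i])
    (ip : {dot H for Num.conj}) (A : set (H -> H)) (tr : (H -> H) -> R[i])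
    (hH : hilbert_norm ip) (hA : von_neumann_algebra ip A)
    (htr : faithful_normal_tracial_state ip A tr)
    (a : H -> H) (ha : A a) (lam : R[i]) :
  ((exists2 delta : R, 0 < delta &
      extends_analytically (derive1 (log_trace ip A tr a lam)) delta) ->
    invertible_in A (a - lam *: idfun) /\ ~ spectrum A a lam) /\
  (~ spectrum A a lam ->
    exists2 delta : R, 0 < delta &
      extends_analytically (derive1 (log_trace ip A tr a lam)) delta).
Proof.
pose A1 := idfun_neq0 (hA := hA) htr.
have Ab : A (a - lam *: idfun).
  have := vn_linear hA (- lam) (vn_id hA) ha.
  by rewrite scaleNr addrC.
pose b : vnalg hA A1 := Vnalg hA A1 _ Ab.
have [Abs adjb] := adj_in_vn _ _ _ _ hA _ Ab.
pose bs : vnalg hA A1 := Vnalg hA A1 _ Abs.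
have adjbR u v : re_ip ip (b u) v = re_ip ip u (bs v) by congr complex.Re; exact: adjb.
pose x := bs * b.
have xb u v : re_ip ip (x u) v = re_ip ip (b u) (b v).
  by rewrite vnopM (ripC ip) -adjbR (ripC ip).
have sax u v : re_ip ip (x u) v = re_ip ip u (x v).
  by rewrite xb (ripC ip u) xb (ripC ip).
have [K K0 bK] := opnorm_le_ex b.
have specb m : (forall u, m * nrm u ^+ 2 <= nrm (b u) ^+ 2) ->
    forall t, specR x t -> m <= t <= K ^+ 2.
  move=> hm; apply: (specR_bounds hH) => u; rewrite xb -(nrm2 _ hH) hm/= -exprMn.
  by rewrite lerXn2r ?nnegrE ?mulr_ge0 ?nrm_ge0 ?(ltW K0)//; exact: bK.
have s0K : forall t, specR x t -> 0 <= t <= K ^+ 2.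
  by apply: specb => u; rewrite mul0r exprn_ge0// nrm_ge0.
have sK t : specR x t -> `|t| <= K ^+ 2.
  by move=> /s0K/andP[t0 tK]; rewrite ger0_norm.
pose L := spectral_mean (hA := hA) (tr := tr) htr x.
have Lm : faithful_mean (specR x) L := spectral_mean_faithful hH htr _ _ sax sK.
have SL e : 0 < e -> log_trace ip A tr a lam e = L (fun t => ln (t + e)).
  move=> e0; apply: (fun_calc_shift hH htr _ _ _ sax).
  by apply: (polyapprox_ln_shift _ _ _ (lexx 0) s0K); rewrite oppr0.
have GL := derive1_mean_ln _ _ _ _ Lm (lexx 0) s0K _ SL.
have invb : invertible_in A (a - lam *: idfun) <-> invertible b.
  exact: (invertible_inP htr b).
split=> [[delta d0 [g [ga gL]]]|/contrapT/invb[U [_ Ub]]].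
  suff h : invertible_in A (a - lam *: idfun) by split=> // -[].
  apply/invb; apply: (invertible_gram hH htr _ _ adjbR); rewrite -/x.
  have [c [r [r0 cg]]] : exists (c : nat -> R) (r : R), 0 < r /\
      forall y, `|y - 0| < r -> pseries c (y - 0) @ \oo --> g y.
    by apply: ga => /=; rewrite oppr_lt0.
  have := mean_analytic_at0 _ _ _ Lm s0K c g r r0.
  rewrite /specR/= scale0r subr0 => h; apply: contrapT; apply: h => [y yr|e e0].
    by have := cg y; rewrite !subr0; apply.
  by rewrite gL// GL.
have [k k0 Uk] := opnorm_le_ex U; pose m := (k ^+ 2)^-1.
have m0 : 0 < m by rewrite invr_gt0 exprn_gt0.
have smK : forall t, specR x t -> m <= t <= K ^+ 2.
  apply: specb => u; rewrite ler_pdivrMl ?exprn_gt0// -exprMn.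
  rewrite lerXn2r ?nnegrE ?mulr_ge0 ?nrm_ge0 ?(ltW k0)//.
  by have := Uk (b u); rewrite -vnopM Ub.
exists m => //; exists (fun e => L (fun t => (t + e)^-1)); split.
  exact: (real_analytic_mean_resolvent _ _ _ _ Lm (ltW m0) smK).
by move=> e e0; rewrite GL.
Qed.
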